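(* Let $\pi:A(V_P)\to A(V_{A_2})$ be the homomorphism of Zhu algebras induced by $V_P\hookrightarrow V_{A_2}$, and let $A_{V_P}=\pi(A(V_P))\le A(V_{A_2})$. Then there is the following description of $A_{V_P}$-modules, for $\lambda\in(\mathbb C\alpha)^\perp$: $$\frac{\Omega_{V_P}(L^{(0,\lambda)})}{\ker(\pi).\Omega_{V_P}(L^{(0,\lambda)})}=\begin{cases}U^{(0,\lambda)}&\text{if }\lambda=0\text{ or }\pm\lambda_2,\\0&\text{if }\lambda\in(\mathbb C\alpha)^\perp\setminus\{0,\pm\lambda_2\}.\end{cases}$$ Moreover, $$\frac{\Omega_{V_P}(L^{(\frac12\alpha,\lambda)})}{\ker(\pi).\Omega_{V_P}(L^{(\frac12\alpha,\lambda)})}=\begin{cases}U^{(\frac12\alpha,\lambda)}&\text{if }\lambda=\pm\frac12\lambda_2,\\0&\text{if }\lambda\in(\mathbb C\alpha)^\perp\setminus\{\pm\frac12\lambda_2\}.\end{cases}$$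
   Context: $A_2=\mathbb Z\alpha\oplus\mathbb Z\beta$ is the root lattice with $(\alpha|\alpha)=(\beta|\beta)=2$, $(\alpha|\beta)=-1$; $\mathfrak h=\mathbb C\otimes A_2$, $(\mathbb C\alpha)^\perp=\{\lambda\in\mathfrak h:(\lambda|\alpha)=0\}$; $\lambda_2=\frac13\alpha+\frac23\beta$ (a fundamental weight). $V_{A_2}=\bigoplus_{\gamma\in A_2}M_{\hat{\mathfrak h}}(1,\gamma)$ is the lattice VOA (level-one Heisenberg modules generated by $e^\gamma$; bimultiplicative cocycle with $\epsilon(\alpha,\alpha)=\epsilon(\beta,\beta)=\epsilon(\alpha,\beta)=1$, $\epsilon(\beta,\alpha)=-1$), and $V_P=\bigoplus_{m\in\mathbb Z,n\ge0}M_{\hat{\mathfrak h}}(1,m\alpha+n\beta)$. Zhu algebra: $A(V)=V/O(V)$, $O(V)=\mathrm{span}\{\mathrm{Res}_zY(a,z)b\,(1+z)^{\mathrm{wt}\,a}/z^2\}$, product $[a]*[b]=\mathrm{Res}_z[Y(a,z)b](1+z)^{\mathrm{wt}\,a}/z$. For a module $W$, $\Omega_V(W)=\{w:a_nw=0\text{ whenever }\mathrm{wt}\,a-n-1<0\}$ is an $A(V)$-module via $[a]\mapsto a_{\mathrm{wt}\,a-1}$. For $\lambda\in(\mathbb C\alpha)^\perp$ and $\varepsilon\in\{0,\frac12\alpha\}$, $L^{(\varepsilon,\lambda)}=\bigoplus_{n\in\mathbb Z}M_{\hat{\mathfrak h}}(1,n\alpha+\varepsilon)\otimes\mathbb Ce^\lambda$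 is the irreducible $V_P$-module on which $M_{\hat{\mathfrak h}}(1,\gamma)$, $\gamma\in\mathbb Z\alpha\oplus\mathbb Z_{>0}\beta$, acts as $0$ and $\bigoplus_nM_{\hat{\mathfrak h}}(1,n\alpha)$ acts by the usual lattice vertex operators $Y(e^{n\alpha},z)=E^-(-n\alpha,z)E^+(-n\alpha,z)e_{n\alpha}z^{n\alpha}$ (and normally ordered products with derivatives of $h(z)=\sum_m h(m)z^{-m-1}$), where $E^\pm(-\gamma,z)=\exp\big(\sum_{k\in\pm\mathbb Z_{>0}}\frac{-\gamma(k)}{k}z^{-k}\big)$, $h(m)$ ($m\ne0$) acts on the first factor, $h(0)=h(0)\otimes\mathrm{Id}+\mathrm{Id}\otimes h(0)$ with $h(0)e^\lambda=(\lambda|h)e^\lambda$, $e_{n\alpha}(e^{m\alpha+\varepsilon}\otimes e^\lambda)=\epsilon(n\alpha,m\alpha)e^{(m+n)\alpha+\varepsilon}\otimes e^\lambda$, $z^{n\alpha}(e^{m\alpha+\varepsilon}\otimes e^\lambda)=z^{(n\alpha|m\alpha+\varepsilon)}e^{m\alpha+\varepsilon}\otimes e^\lambda$. Their bottom degrees are the $A(V_P)$-modules $\Omega_{V_P}(L^{(0,\lambda)})=U^{(0,\lambda)}=\mathbb Ce$ with $e=\mathbf 1\otimes e^\lambda$, and $\Omega_{V_P}(L^{(\frac12\alpha,\lambda)})=U^{(\frac12\alpha,\lambda)}=\mathbb Ce^+\oplus\mathbb Ce^-$ with $e^\pm=e^{\pm\frac12\alpha}\otimes e^\lambda$. With $x=[\alpha(-1)\mathbf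 1]$, $y=[\beta(-1)\mathbf 1]$, $x_\gamma=[e^\gamma]$: $x_\beta,x_{\alpha+\beta}$ act as $0$ on both; $x_{\pm\alpha}.e=x.e=0$, $y.e=(\lambda|\beta)e$; $x_\alpha.e^+=0$, $x_\alpha.e^-=e^+$, $x_{-\alpha}.e^+=e^-$, $x_{-\alpha}.e^-=0$, $x.e^\pm=\pm e^\pm$, $y.e^\pm=((\lambda|\beta)\mp\frac12)e^\pm$. *)

(* Defs.v *)
From HB Require Import structures.
From mathcomp Require Import all_boot all_order all_algebra.
From mathcomp Require Import generic_quotient ring_quotient.
From mathcomp Require Import finmap.
From mathcomp Require Import complex.
From mathcomp Require Import monalg.
From mathcomp Require Import boolp classical_sets functions fsbigop reals.

Set Implicit Arguments.
Unset Strict Implicit.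
Unset Printing Implicit Defensive.

Import GRing.Theory.
Local Open Scope classical_set_scope.
Local Open Scope ring_scope.
Local Open Scope quotient_scope.

Section Quotients.
Context {K : fieldType} {W : lmodType K}.
Implicit Types (A : set W).

Definition lspan A : set W :=
  [set w | exists (n : nat) (c : 'I_n -> K) (v : 'I_n -> W),
     (forall i, A (v i)) /\ w = \sum_(i < n) c i *: v i].

Definition subspace (S : set W) : Prop :=
  S 0 /\ forall (c : K) u v, S u -> S v -> S (c *: u + v).

Lemma lspan_subspace A : subspace (lspan A).
Proof.
split; first by exists 0, (fun=> 0), (fun=> 0); split; [case | rewrite big_ord0].
move=> c u v [n [a [x [Ax ->]]]] [p [b [y [Ay ->]]]].
exists (n + p)%N, (fun i : 'I_(n + p) => match fintype.split i with inl j => c * a j | inr j => b j end),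
  (fun i : 'I_(n + p) => match fintype.split i with inl j => x j | inr j => y j end).
split; first by move=> i; case: (fintype.split i).
rewrite big_split_ord scaler_sumr /=; congr (_ + _); apply: eq_bigr => i _.
  by rewrite -[lshift _ _]/(unsplit (inl i)) unsplitK scalerA.
by rewrite -[rshift _ _]/(unsplit (inr i)) unsplitK.
Qed.

Definition in_lspan A : {pred W} := fun w => `[< lspan A w >].

Lemma in_lspan_closed A : zmod_closed (in_lspan A).
Proof.
have [S0 SD] := lspan_subspace A; split; first exact/asboolP.
move=> u v /asboolP Su /asboolP Sv; apply/asboolP.
by rewrite addrC -scaleN1r; apply: SD.
Qed.
HB.instance Definition _ A :=
  GRing.isZmodClosed.Build W (in_lspan A) (in_lspan_closed A).

Definition quo A := Quotient.quot (in_lspan A).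
HB.instance Definition _ A := GRing.Zmodule.on (quo A).

Definition cls A (w : W) : quo A := \pi_(Quotient.quot (in_lspan A)) w.

Definition quo_repr A (q : quo A) : W := repr (q : Quotient.quot (in_lspan A)).

Lemma cls_repr A (q : quo A) : cls A (quo_repr q) = q.
Proof. exact: reprK. Qed.

Lemma clsP A u v : cls A u = cls A v <-> lspan A (u - v).
Proof.
split.
  by move=> /eqP; rewrite -Quotient.idealrBE => /asboolP.
by move=> H; apply/eqP; rewrite -Quotient.idealrBE; apply/asboolP.
Qed.

Lemma clsD A : {morph cls A : u v / u + v}.
Proof. exact: Quotient.pi_add. Qed.

Definition quo_scale A (c : K) (q : quo A) : quo A := cls A (c *: quo_repr q).

Lemma quo_scaleE A c w : quo_scale c (cls A w) = cls A (c *: w).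
Proof.
apply/clsP; rewrite -scalerBr -[_ *: _]addr0.
have [S0 SD] := lspan_subspace A.
by apply: SD => //; apply/clsP; rewrite cls_repr.
Qed.

Fact quo_scaleA A a b (q : quo A) :
  quo_scale a (quo_scale b q) = quo_scale (a * b) q.
Proof. by rewrite -(cls_repr q) !quo_scaleE scalerA. Qed.
Fact quo_scale1 A : left_id 1 (@quo_scale A).
Proof. by move=> q; rewrite -(cls_repr q) quo_scaleE scale1r. Qed.
Fact quo_scaleDr A : right_distributive (@quo_scale A) +%R.
Proof.
move=> a q r; rewrite -(cls_repr q) -(cls_repr r).
by rewrite !(=^~ clsD, quo_scaleE) scalerDr.
Qed.
Fact quo_scaleDl A (q : quo A) : {morph (@quo_scale A)^~ q : a b / a + b}.
Proof.
by move=> a b /=; rewrite -(cls_repr q) !quo_scaleE -clsD scalerDl.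
Qed.
HB.instance Definition _ A := GRing.Zmodule_isLmodule.Build K (quo A)
  (@quo_scaleA A) (@quo_scale1 A) (@quo_scaleDr A) (@quo_scaleDl A).

End Quotients.

(* The additive group A_2 is int^2, a row (m, n) standing for m alpha + n beta,
   and h is C^2 in the same coordinates. *)
Section RootLattice.
Context {T : comNzRingType}.

Definition pair_form (u v : 'rV[T]_2) : T :=
  u 0 0 * v 0 0 *+ 2 + u 0 1 * v 0 1 *+ 2 - u 0 0 * v 0 1 - u 0 1 * v 0 0.

Definition alpha : 'rV[T]_2 := delta_mx 0 0.
Definition beta : 'rV[T]_2 := delta_mx 0 1.

End RootLattice.

Notation A2 := 'rV[int]_2.

Section Fock.
Context {R : realType}.
Local Notation C := (R[i]).
Local Notation h := 'rV[C]_2.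

Definition emb (g : A2) : h := map_mx intr g.

Definition simple (s : 'I_2) : h := delta_mx 0 s.

(* The generator (s, k) is gamma_s(-k-1), where gamma_0 = alpha, gamma_1 = beta,
   so that monomials in these generators form a basis of M(1) = S(h^-). *)
Notation gen := ('I_2 * nat)%type.
Notation hmon := {cmonom gen}.

(* Direct sums of Heisenberg modules M(1, mu_i), where i ranges over lab, with
   the data through which e^g acts on them:
     h(0) e^i = (h | mu i) e^i, z^g e^i = z^(zpow g i) e^i,
     e_g e^i = ecoef g i e^(shift g i). *)
Record latdata := LatData {
  lab : choiceType;
  mu : lab -> h;
  shift : A2 -> lab -> lab;
  ecoef : A2 -> lab -> C;
  zpow : A2 -> lab -> int }.

Section Operators.
Variable D : latdata.
Notation key := (hmon * lab D)%type.

Definition fock := {malg C[key]}.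
HB.instance Definition _ := GRing.Lmodule.on fock.

Definition vec (m : hmon) (i : lab D) : fock := << ((m, i) : key) >>.

Definition lext (f : hmon -> lab D -> fock) (w : fock) : fock :=
  \sum_(k <- msupp w) w@_k *: f k.1 k.2.

Definition heis (u : h) (n : int) : fock -> fock :=
  match n with
  | Posz 0 => lext (fun m i => pair_form u (mu i) *: vec m i)
  | Posz k.+1 => lext (fun m i =>
      \sum_(s < 2) (k.+1%:R * pair_form u (simple s) * (m (s, k))%:R)
                     *: vec (divcm m (ucm (s, k))) i)
  | Negz k => lext (fun m i =>
      \sum_(s < 2) u 0 s *: vec (mulcm m (ucm (s, k))) i)
  end.

(* Power series with operator coefficients. *)
Definition opser := nat -> fock -> fock.

Definition ser_one : opser := fun n w => if n is 0 then w else 0.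
Definition ser_mul (A B : opser) : opser :=
  fun n w => \sum_(i < n.+1) A i (B (n - i)%N w).
(* For A 0 = 0, so that A ^ j does not contribute to degree n when j > n. *)
Definition ser_exp (A : opser) : opser :=
  fun n w => \sum_(j < n.+1) (j`!%:R)^-1 *: iter j (ser_mul A) ser_one n w.

(* E^-(-g, z) = \sum_p Eminus g p z^p and E^+(-g, z) = \sum_q Eplus g q z^-q. *)
Definition Eminus (g : A2) : opser :=
  ser_exp (fun n w => if n is k.+1
                      then (k.+1%:R)^-1 *: heis (emb g) (- k.+1%:Z) w else 0).
Definition Eplus (g : A2) : opser :=
  ser_exp (fun n w => if n is k.+1
                      then - (k.+1%:R)^-1 *: heis (emb g) k.+1%:Z w else 0).

(* The coefficient of z^(-n-1) in E^-(-g, z) E^+(-g, z) e_g z^g. *)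
Definition Yexp (g : A2) (n : int) : fock -> fock :=
  lext (fun m i => \sum_(q \in [set: nat])
    if (q%:Z - zpow g i - n - 1)%R is Posz p
    then Eminus g p (Eplus g q (ecoef g i *: vec m (shift g i))) else 0).

(* The coefficient of z^(-n-1) in the normally ordered product
   :d^(k_1) gamma_{s_1}(z) ... d^(k_r) gamma_{s_r}(z) Y(e^g, z):, with
   d^(k) = (d/dz)^k / k!.  All the sums over nat below have finite support. *)
Fixpoint Ynop (l : seq gen) (g : A2) : int -> fock -> fock :=
  if l is (s, k) :: l' then fun n w =>
    \sum_(j \in [set: nat])
       'C(j + k, k)%:R *: heis (simple s) (- (j + k).+1%:Z) (Ynop l' g (n + j%:Z) w)
    + \sum_(j \in [set: nat])
       ((-1) ^+ k * 'C(j + k, k)%:R)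
         *: Ynop l' g (n - (j + k).+1%:Z) (heis (simple s) j%:Z w)
  else Yexp g.

Definition gens (m : hmon) : seq gen :=
  flatten [seq nseq (m x) x | x <- finsupp m].

Definition Ybasis (m : hmon) (g : A2) : int -> fock -> fock := Ynop (gens m) g.

End Operators.

Definition eps (g d : A2) : C := (-1) ^ (g 0 1 * d 0 0).

Definition dataA2 : latdata :=
  LatData emb +%R eps pair_form.

Local Notation VA2 := (fock dataA2).

Definition vac : VA2 := @vec dataA2 (onecm _) 0.

(* The vector space of V_P. *)
Definition VP : set VA2 :=
  [set v | forall m (g : A2), v@_(m, g) != 0 -> (0 <= g 0 1)%R].

Definition wt (k : hmon * A2) : nat :=
  (\sum_(x <- finsupp k.1) k.1 x * x.2.+1 + `|pair_form k.2 k.2|./2)%N.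

Definition homog (d : nat) (a : VA2) : Prop :=
  forall k, k \in msupp a -> wt k = d.

Definition mode (D : latdata) (a : VA2) (n : int) (w : fock D) : fock D :=
  \sum_(k <- msupp a) a@_k *: Ybasis k.1 k.2 n w.

Definition zmode (D : latdata) (a : VA2) (w : fock D) : fock D :=
  \sum_(k <- msupp a) a@_k *: Ybasis k.1 k.2 ((wt k)%:Z - 1) w.

(* Res_z Y(a, z) b (1 + z)^(wt a) z^-r for homogeneous a, extended linearly. *)
Definition zres (r : nat) (a b : VA2) : VA2 :=
  \sum_(k <- msupp a) a@_k *: \sum_(i < (wt k).+1)
    'C(wt k, i)%:R *: Ybasis k.1 k.2 (i%:Z - r%:Z) b.

Definition zhu_circ : VA2 -> VA2 -> VA2 := zres 2.
Definition zhu_star : VA2 -> VA2 -> VA2 := zres 1.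

(* For a vertex subalgebra V of V_{A_2}: O(V) is the span of these elements, and the
   product of A(V) = V / O(V) is [a] * [b] = [zhu_star a b]. *)
Definition Ogen (V : set VA2) : set VA2 :=
  [set x | exists d a b, [/\ V a, homog d a, V b & x = zhu_circ a b]].

Local Notation ZA2 := (quo (Ogen [set: VA2])).

(* A(V_P) = V_P / O(V_P), as a set of cosets in V_{A_2} / O(V_P). *)
Definition ZP : set (quo (Ogen VP)) := cls (Ogen VP) @` VP.

Definition zpi (x : quo (Ogen VP)) : ZA2 := cls (Ogen [set: VA2]) (quo_repr x).

Lemma zpi_cls (v : VA2) : zpi (cls (Ogen VP) v) = cls (Ogen [set: VA2]) v.
Proof.
apply/clsP; have /clsP : cls (Ogen VP) (quo_repr (cls (Ogen VP) v)) = cls (Ogen VP) v.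
  exact: cls_repr.
move=> [n [c [x [Ox ->]]]]; exists n, c, x; split=> // i.
by have [d [a [b [_ ha _ ->]]]] := Ox i; exists d, a, b.
Qed.

Definition ker_pi : set (quo (Ogen VP)) := [set x | ZP x /\ zpi x = 0].

Definition AVP : set ZA2 := zpi @` ZP.

(* act makes the subspace M of W a (unital, left) module over A_{V_P}.  The
   values of act outside A_{V_P} and M are irrelevant. *)
Definition AVP_module (W : lmodType C) (M : set W) (act : ZA2 -> W -> W) : Prop :=
  [/\ subspace M,
      forall x u, AVP x -> M u -> M (act x u),
      (forall c x u v, AVP x -> M u -> M v ->
         act x (c *: u + v) = c *: act x u + act x v) /\
      (forall c x y u, AVP x -> AVP y -> M u ->
         act (c *: x + y) u = c *: act x u + act y u),
      forall u, M u -> act (cls _ vac) u = u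
    & forall a b u, VP a -> VP b -> M u ->
         act (cls _ (zhu_star a b)) u = act (cls _ a) (act (cls _ b) u)].

Section Modules.
Variables (e : bool) (lam : h).

Definition epsv : h := if e then 2%:R^-1 *: alpha else 0.

(* L^(epsv, lam) = (+)_n M(1, n alpha + epsv) (x) e^lam, the label n standing for
   e^(n alpha + epsv) (x) e^lam.  Here (m alpha | n alpha + epsv) = (m alpha | n alpha)
   + m (alpha | epsv), and (alpha | epsv) = e.  The coefficient vanishes on
   g outside Z alpha, so that M(1, g) then acts as 0. *)
Definition dataL : latdata :=
  LatData (fun n : int => emb (alpha *~ n) + epsv + lam)
          (fun g n => g 0 0 + n)
          (fun g n => if g 0 1 == 0 then eps g (alpha *~ n) else 0)
          (fun g n => pair_form g (alpha *~ n) + g 0 0 *+ e).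

Local Notation L := (fock dataL).

Definition Omega : set L :=
  [set w | forall d a n, VP a -> homog d a -> (d%:Z - n - 1 < 0)%R -> mode a n w = 0].

(* Generators of ker(pi).Omega; [a] acts by the zero mode of a. *)
Definition kerOmega : set L :=
  [set w | exists a u, [/\ VP a, ker_pi (cls _ a), Omega u & w = zmode a u]].

(* Omega / ker(pi).Omega, as a set of cosets in L / ker(pi).Omega. *)
Definition OmegaQ : set (quo kerOmega) := cls kerOmega @` Omega.

(* For e = true, the labels 0 and -1 are e^+ and e^-. *)
Definition Ubot : set L :=
  lspan (if e then [set @vec dataL (onecm _) 0; @vec dataL (onecm _) (-1)]
        else [set @vec dataL (onecm _) 0]).

(* Omega / ker(pi).Omega = U^(epsv, lam) as A_{V_P}-modules: A_{V_P} acts on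
   both sides by pi([a]).u = a_{wt a - 1} u, and u |-> u + ker(pi).Omega is an
   isomorphism of modules from Ubot to Omega / ker(pi).Omega. *)
Definition OmegaQ_eq_U : Prop :=
  exists (actU : ZA2 -> L -> L) (actQ : ZA2 -> quo kerOmega -> quo kerOmega),
  [/\ AVP_module Ubot actU
       /\ (forall a u, VP a -> Ubot u -> actU (zpi (cls _ a)) u = zmode a u),
      AVP_module OmegaQ actQ
       /\ (forall a w, VP a -> Omega w ->
             actQ (zpi (cls _ a)) (cls _ w) = cls _ (zmode a w)),
      set_bij Ubot OmegaQ (cls kerOmega)
    & forall x u, AVP x -> Ubot u -> cls _ (actU x u) = actQ x (cls _ u)].

Definition OmegaQ_eq_0 : Prop := OmegaQ = [set 0].

End Modules.

Definition lambda2 : h := 3%:R^-1 *: alpha + (2%:R / 3%:R) *: beta.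

End Fock.

(* Main.v *)
Require Import Defs.
From HB Require Import structures.
From mathcomp Require Import all_boot all_order all_algebra.
From mathcomp Require Import finmap complex monalg.
From mathcomp Require Import boolp classical_sets functions fsbigop reals.
From mathcomp Require Import zify ring.

Set Implicit Arguments.
Unset Strict Implicit.
Unset Printing Implicit Defensive.

Import Order.TTheory GRing.Theory Num.Theory.
Local Open Scope ring_scope.

(** The proof replaces the general theory of Zhu algebras by one residue
    computation.

    On a vector e^mu of lowest weight the zero mode of a = m (x) e^g is explicit:
    each factor gamma(-k-1) of the monomial m contributes the scalar
    (-1)^k (gamma|mu), and e^mu goes to e^(mu + g) if this vector again has lowest
    weight, and to 0 otherwise (zmode_hw).  So the zero modes on the bottom are
    recorded by functionals phi on V_{A_2}, one for each mu and g.

    Under phi every creation operator of Y(a,z)b becomes a scalar, and the resulting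
    series are powers of 1 + z; for instance
      phi (Y(e^g,z) e^g') = eps(g,g') z^(g|g') (1 + z)^(g|mu),
    because exp (x log (1 + z)) = (1 + z)^x.  The factor (1 + z)^(wt a) of Zhu's
    products clears all denominators, and what remains is z^M times a polynomial in
    1/z, where
      M = (g|g') + (g|g)/2 + (g|mu) = (|mu + g + g'|^2 - |mu + g'|^2) / 2,
    with leading coefficient eps(g,g') times the product of the scalars by which a acts
    on e^(mu + g') and b on e^mu (phi_Ynop_starts).  If mu + g + g' has minimal norm in
    mu + A_2, then M <= 0: the residue against z^-2 vanishes, so O(V_{A_2}) acts by
    zero (phi_circ), and the residue against z^-1 is the product of the two zero
    modes if mu + g' is also of minimal norm, and 0 otherwise (phi_star).

    The bottom vectors of L^(epsv,lam) are minimal vectors of the dual lattice of A_2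
    exactly for the listed values of lam (min_weights).  For these, ker(pi) acts by
    zero on the bottom, which is Omega, and the quotient is the whole of U.  For all
    other lam, e^g o e^(-g) with g = beta or g = alpha + beta lies in V_P and in
    O(V_{A_2}), and acts on e^mu by the scalar +- binomial((g|mu) + 1, 3), which is
    zero only if (g|mu) is 0, 1 or -1 (phi_circ_opp); for each bottom vector one of
    the two choices of g gives a nonzero scalar, so ker(pi).Omega is everything.

    That Omega is the bottom degree (Ubot_Omega, Omega_Ubot) comes from the grading
    on one side; on the other, the positive Heisenberg modes leave only combinations
    of the vectors e^i = e^(i alpha + epsv) (x) e^lam, and a mode of the vertex operator
    of e^(-i alpha) detects each e^i of higher weight. *)

(** * Linear extension from a basis *)

Section Extension.
Context {K : choiceType} {F : fieldType} {W : lmodType F}.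

Definition malg_lift (f : K -> W) (w : {malg F[K]}) : W :=
  \sum_(k <- msupp w) w@_k *: f k.

Lemma malg_liftEw f w (d : {fset K}) : (msupp w `<=` d)%fset ->
  malg_lift f w = \sum_(k <- d) w@_k *: f k.
Proof.
move=> le; apply: big_fset_incl => // k _.
by move/mcoeff_outdom=> ->; rewrite scale0r.
Qed.

Lemma malg_lift_is_linear f : linear (malg_lift f).
Proof.
move=> c u v.
set d := (msupp u `|` msupp v)%fset.
have le : (msupp (c *: u + v) `<=` d)%fset.
  apply: (fsubset_trans (msuppD_le _ _)); apply: fsetUSS => //.
  exact: msuppZ_le.
rewrite (malg_liftEw f le) (malg_liftEw f (fsubsetUl _ _ : (msupp u `<=` d)%fset)).
rewrite (malg_liftEw f (fsubsetUr _ _ : (msupp v `<=` d)%fset)).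
rewrite scaler_sumr -big_split /=; apply: eq_bigr => k _.
by rewrite mcoeffD mcoeffZ scalerDl scalerA.
Qed.
HB.instance Definition _ f :=
  GRing.isLinear.Build F {malg F[K]} W *:%R (malg_lift f) (malg_lift_is_linear f).

Lemma malg_liftU f k : malg_lift f << k >> = f k.
Proof.
rewrite /malg_lift msuppU oner_eq0 big_seq_fset1 mcoeffUU scale1r //.
Qed.

Lemma malgUZ c k : << c *g k >> = c *: << k >> :> {malg F[K]}.
Proof. by apply/malgP => k'; rewrite mcoeffZ !mcoeffU mulr_natr. Qed.

Lemma malg_ind (P : {malg F[K]} -> Prop) : P 0 ->
  (forall c k v, P v -> P (c *: << k >> + v)) -> forall w, P w.
Proof.
move=> P0 PD w; rewrite (monalgE w).
elim: {1}(enum_fset _) => [|k s IH]; first by rewrite big_nil.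
rewrite big_cons malgUZ; exact: PD.
Qed.

End Extension.

Lemma linear_malg_eq (K : choiceType) (F : fieldType) (W : lmodType F)
    (f g : {linear {malg F[K]} -> W}) :
  (forall k, f << k >> = g << k >>) -> f =1 g.
Proof.
move=> E; apply: malg_ind => [|c k v IH]; first by rewrite !linear0.
by rewrite !linearP IH E.
Qed.

Section Fock.
Context {R : realType}.
Local Notation C := R[i].
Notation gen := ('I_2 * nat)%type.
Notation hmon := {cmonom gen}.

Section Gen.
Variable D : latdata (R:=R).
Local Notation fock := (fock D).
Implicit Types (w : fock).

Lemma lext_is_linear f : linear (@lext R D f).
Proof. exact: malg_lift_is_linear. Qed.
HB.instance Definition _ f :=
  GRing.isLinear.Build C fock fock *:%R (lext f) (lext_is_linear f).

Lemma lext_vec f m i : lext f (@vec R D m i) = f m i.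
Proof. exact: (malg_liftU (fun k => f k.1 k.2)). Qed.

Lemma heis_is_linear u n : linear (@heis R D u n).
Proof. by case: n => [[|k]|k]; apply: lext_is_linear. Qed.
HB.instance Definition _ u n :=
  GRing.isLinear.Build C fock fock *:%R (@heis R D u n) (heis_is_linear u n).

End Gen.
End Fock.

(** * Subspaces and finitely supported sums *)

Section Subspaces.
Context {K : fieldType} {W : lmodType K}.
Variable S : set W.
Hypothesis subS : subspace S.

Lemma subspace0 : S 0. Proof. by case: subS. Qed.

Lemma subspaceZ c u : S u -> S (c *: u).
Proof. by move=> Su; rewrite -[_ *: _]addr0; apply: subS.2 => //; apply: subspace0. Qed.

Lemma subspaceD u v : S u -> S v -> S (u + v).
Proof. by move=> Su Sv; rewrite -[u]scale1r; apply: subS.2. Qed.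

Lemma subspace_sum I (r : seq I) (P : pred I) (f : I -> W) :
  (forall i, P i -> S (f i)) -> S (\sum_(i <- r | P i) f i).
Proof. by move=> Sf; apply: big_ind => //; [apply: subspace0|apply: subspaceD]. Qed.

Lemma subspace_malg_lift (T : choiceType) (f : T -> W) (w : {malg K[T]}) :
  (forall k, w@_k != 0 -> S (f k)) -> S (malg_lift f w).
Proof.
move=> Sf; rewrite /malg_lift big_seq; apply: subspace_sum => k kw; apply: subspaceZ.
by apply: Sf; rewrite mcoeff_neq0.
Qed.

Lemma subspace_lspan (A : set W) : (forall w, A w -> S w) -> forall w, lspan A w -> S w.
Proof.
move=> AS w [n [c [v [Av ->]]]]; apply: subspace_sum => i _.
exact/subspaceZ/AS.
Qed.
End Subspaces.

Lemma fsbig_nat_trunc (W : nmodType) (f : nat -> W) J :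
  (forall j, (J <= j)%N -> f j = 0) ->
  (\sum_(j \in [set: nat]) f j = \sum_(j < J) f j)%R.
Proof.
move=> f0; rewrite fsbig_ord; symmetry; apply: fsbig_widen => // j [_ /= /negP].
by rewrite -leqNgt => /f0.
Qed.

(** * Weights of monomials *)

Section Weights.
Notation gen := ('I_2 * nat)%type.
Notation hmon := {cmonom gen}.

Definition seqwt (l : seq gen) : nat := \sum_(x <- l) x.2.+1.

(** gens lists a monomial with multiplicity, in an unspecified order; it is only ever
    used up to permutation, through this count. *)
Lemma count_gens (m : hmon) x : count_mem x (gens m) = m x.
Proof.
rewrite /gens count_flatten -map_comp sumnE big_map /=.
rewrite (eq_bigr (fun y => (y == x) * m y)%N); last first.
  by move=> y _; rewrite count_nseq.
case: (mdomP m x) => [xm|xm].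
  rewrite (big_fsetD1 x) //= eqxx mul1n big_seq big1 ?addn0 // => y.
  by rewrite !inE => /andP[/negbTE ->].
rewrite big_seq big1 // => y ym; case: eqP => // yx.
by move: ym; rewrite yx (negbTE xm).
Qed.

Lemma gensM (m : hmon) x : perm_eq (gens (mulcm m (ucm x))) (x :: gens m).
Proof.
by apply/allP => y _ /=; rewrite !count_gens mulcmE ucmE addnC.
Qed.

Lemma gens1 : gens (onecm gen) = [::].
Proof.
case E : (gens _) => [//|x s].
by have := count_gens (onecm gen) x; rewrite E /= eqxx onecmE.
Qed.

Lemma gens_nil (m : hmon) : gens m = [::] -> m = onecm _.
Proof. by move=> E; apply/eqP/cmP => x; rewrite -count_gens E onecmE. Qed.

Lemma seqwt_gensM (m : hmon) x :
  seqwt (gens (mulcm m (ucm x))) = (seqwt (gens m) + x.2.+1)%N.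
Proof. by rewrite /seqwt (perm_big _ (gensM m x)) big_cons addnC. Qed.

Lemma seqwt_gens0 (m : hmon) : seqwt (gens m) = 0%N -> m = onecm _.
Proof.
move=> E; apply: gens_nil; move: E; case: (gens m) => //= x s.
by rewrite /seqwt big_cons addSn.
Qed.

Lemma wt_seqwt (k : hmon * A2) : wt k = (seqwt (gens k.1) + `|pair_form k.2 k.2|./2)%N.
Proof.
rewrite /wt; congr (_ + _)%N; rewrite /seqwt /gens big_flatten big_map /=.
by apply: eq_bigr => x _; rewrite big_nseq iter_addn_0 mulnC.
Qed.

Lemma divcmK (m : hmon) x : m x != 0%N -> mulcm (divcm m (ucm x)) (ucm x) = m.
Proof.
move=> mx; apply/eqP/cmP => y; rewrite mulcmE divcmE ucmE.
case: eqP => [<-|_] /=; last by rewrite subn0 addn0.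
by rewrite subnK // lt0n.
Qed.

Lemma mulcmK (m : hmon) x : divcm (mulcm m (ucm x)) (ucm x) = m.
Proof. by apply/eqP/cmP => y; rewrite divcmE mulcmE addnK. Qed.
End Weights.

Arguments heis : simpl never.
Arguments Eminus : simpl never.
Arguments Eplus : simpl never.

(** * Vertex operators: grading, linearity, truncation *)

Section Homogeneity.
Context {R : realType}.
Local Notation C := R[i].
Notation gen := ('I_2 * nat)%type.
Notation hmon := {cmonom gen}.

Section Gen.
Variable D : latdata (R:=R).
Local Notation fock := (fock D).
Implicit Types (w : fock) (e : int) (i : lab D).

Lemma fock_ind (P : fock -> Prop) : P 0 ->
  (forall c m i v, P v -> P (c *: vec m i + v)) -> forall w, P w.
Proof. by move=> P0 PD; apply: malg_ind => // c [m i] v; apply: PD. Qed.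

Lemma linear_fock_eq (W : lmodType C) (f g : {linear fock -> W}) :
  (forall m i, f (vec m i) = g (vec m i)) -> f =1 g.
Proof. by move=> E; apply: linear_malg_eq => -[m i]; apply: E. Qed.

Lemma vecE m i k : (@vec R D m i)@_k = ((m, i) == k)%:R.
Proof. by rewrite mcoeffU. Qed.

(** The degree is an integer, so that a vertex operator may be said to land in a
    negative degree, which forces the value 0. *)
Definition bihom e i : set fock :=
  [set w | forall k, w@_k != 0 -> (seqwt (gens k.1))%:Z = e /\ k.2 = i]%classic.

Lemma bihom_subspace e i : subspace (bihom e i).
Proof.
split=> [k|c u v Hu Hv k]; first by rewrite mcoeff0 eqxx.
rewrite mcoeffD mcoeffZ; have [v0|/Hv//] := eqVneq v@_k 0.
have [u0|/Hu//] := eqVneq u@_k 0.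
by rewrite v0 u0 mulr0 addr0 eqxx.
Qed.

Lemma bihom_vec m i : bihom (seqwt (gens m)) i (vec m i).
Proof. by move=> k; rewrite vecE; case: ((m, i) =P k) => [<-//|_]; rewrite eqxx. Qed.

Lemma bihom_eq e e' i w : bihom e i w -> e = e' -> bihom e' i w.
Proof. by move=> Hw <-. Qed.

Lemma bihom_lt0 e i w : e < 0 -> bihom e i w -> w = 0.
Proof.
move=> e0 Hw; apply/malgP => k; rewrite mcoeff0.
by apply/eqP; apply/negPn/negP => /Hw[]; lia.
Qed.

Lemma subspace_lext (S : set fock) f w : subspace S ->
  (forall m i, w@_(m, i) != 0 -> S (f m i)) -> S (lext f w).
Proof.
move=> subS Sf; apply: (@subspace_malg_lift _ _ _ subS _ (fun k => f k.1 k.2) w).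
by case=> m i; apply: Sf.
Qed.

Lemma bihom_heis u n e i w : bihom e i w -> bihom (e - n) i (heis u n w).
Proof.
move=> Hw; have S d := bihom_subspace d i; case: n => [[|k]|k];
  rewrite /heis; apply: (subspace_lext (S _)) => m j /Hw /= [Ek Ei].
- apply: (subspaceZ (S _)); rewrite Ei.
  have -> : e - Posz 0 = seqwt (gens m) by rewrite -Ek; lia.
  exact: bihom_vec.
- apply: (subspace_sum (S _)) => s _.
  have [->|ms] := eqVneq (m (s, k)) 0%N; first by rewrite mulr0 scale0r; apply: subspace0.
  apply: (subspaceZ (S _)); rewrite Ei.
  have -> : e - k.+1%:Z = seqwt (gens (divcm m (ucm (s, k)))).
    have := seqwt_gensM (divcm m (ucm (s, k))) (s, k); rewrite (divcmK ms) -Ek /= => ->.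
    by rewrite PoszD addrK.
  exact: bihom_vec.
- apply: (subspace_sum (S _)) => s _.
  apply: (subspaceZ (S _)); rewrite Ei.
  have -> : e - Negz k = seqwt (gens (mulcm m (ucm (s, k)))).
    by rewrite seqwt_gensM /= -Ek NegzE opprK PoszD.
  exact: bihom_vec.
Qed.

Arguments bihom_heis u n {e i w} _ _ _.
Arguments bihom_vec m i _ _ : clear implicits.

Definition graded (sgn : int) (A : opser D) : Prop :=
  forall n e i w, bihom e i w -> bihom (e + sgn * n%:Z) i (A n w).

Lemma graded_one sgn : graded sgn (@ser_one R D).
Proof.
move=> [|n] e i w Hw /=; first by rewrite mulr0 addr0.
exact: (subspace0 (bihom_subspace _ _)).
Qed.

Lemma graded_mul sgn A B : graded sgn A -> graded sgn B -> graded sgn (ser_mul A B).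
Proof.
move=> gA gB n e i w Hw; apply: (subspace_sum (bihom_subspace _ _)) => j _.
have -> : e + sgn * n%:Z = e + sgn * (n - j)%N%:Z + sgn * j%:Z.
  by rewrite -addrA -mulrDr -PoszD subnK // -ltnS.
by apply: gA; apply: gB.
Qed.

Arguments graded_mul {sgn A B}.

Lemma graded_exp sgn A : graded sgn A -> graded sgn (ser_exp A).
Proof.
move=> gA n e i w Hw; apply: (subspace_sum (bihom_subspace _ _)) => j _.
apply: (subspaceZ (bihom_subspace _ _)).
have : graded sgn (iter j (ser_mul A) (@ser_one R D)).
  by elim: (j : nat) => [|k IH] /=; [apply: graded_one|apply: graded_mul].
by apply.
Qed.

Lemma graded_Eminus g : graded 1 (@Eminus R D g).
Proof.
apply: graded_exp => -[|n] e i w Hw; first exact: (subspace0 (bihom_subspace _ _)).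
apply: (subspaceZ (bihom_subspace _ _)).
have := bihom_heis (emb g) (- n.+1%:Z) Hw; by rewrite opprK mul1r.
Qed.

Lemma graded_Eplus g : graded (-1) (@Eplus R D g).
Proof.
apply: graded_exp => -[|n] e i w Hw; first exact: (subspace0 (bihom_subspace _ _)).
apply: (subspaceZ (bihom_subspace _ _)).
have := bihom_heis (emb g) n.+1%:Z Hw; by rewrite mulN1r.
Qed.

Lemma bihom_fsum e i (f : nat -> fock) : (forall j, bihom e i (f j)) ->
  bihom e i (\sum_(j \in [set: nat]) f j)%R.
Proof. by move=> Hf; apply: (subspace_sum (bihom_subspace _ _)). Qed.

Lemma bihom_Yexp g n e i w : bihom e i w ->
  bihom (e - n - 1 - zpow g i) (shift g i) (Yexp g n w).
Proof.
have S d j := bihom_subspace d j.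
move=> Hw; apply: (subspace_lext (S _ _)) => m j /Hw /= [Em ->].
apply: bihom_fsum => q; case E : (q%:Z - zpow g i - n - 1) => [p|p]; last exact: subspace0.
have -> : e - n - 1 - zpow g i = e + (-1) * q%:Z + 1 * p%:Z by lia.
apply: graded_Eminus; apply: graded_Eplus; apply: (subspaceZ (S _ _)).
by rewrite -Em; apply: bihom_vec.
Qed.

(** Stated for an arbitrary list of generators and an arbitrary mode, so that the
    induction on the list goes through. *)
Lemma bihom_Ynop l g n e i w : bihom e i w ->
  bihom (e + (seqwt l)%:Z - n - 1 - zpow g i) (shift g i) (Ynop l g n w).
Proof.
have S d j := bihom_subspace d j.
elim: l n e w => [|[s k] l IH] n e w Hw /=.
  by rewrite /seqwt big_nil addr0; apply: bihom_Yexp.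
rewrite /seqwt big_cons -/(seqwt l) /=; apply: (subspaceD (S _ _)); apply: bihom_fsum => j.
  apply: (subspaceZ (S _ _)).
  by apply: bihom_eq (bihom_heis (simple s) (- (j + k).+1%:Z) (IH (n + j%:Z) _ _ Hw)) _; lia.
apply: (subspaceZ (S _ _)).
by apply: bihom_eq (IH (n - (j + k).+1%:Z) _ _ (bihom_heis (simple s) j%:Z Hw)) _; lia.
Qed.

Arguments bihom_Ynop l g n {e i w} _ _ _.
Lemma ser_exp_is_linear (A : opser D) : (forall n, linear (A n)) ->
  forall n, linear (ser_exp A n).
Proof.
move=> lA n; have lp j : forall n, linear (iter j (ser_mul A) (@ser_one R D) n).
  elim: j => [|j IH] p c u v.
    by case: p => [|p] //=; rewrite scaler0 addr0.
  rewrite /= /ser_mul scaler_sumr -big_split /=; apply: eq_bigr => i _.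
  by rewrite IH lA.
move=> c u v; rewrite /ser_exp scaler_sumr -big_split /=; apply: eq_bigr => j _.
by rewrite lp scalerDr !scalerA mulrC.
Qed.

Lemma Eminus_is_linear g p : linear (@Eminus R D g p).
Proof.
apply: ser_exp_is_linear => -[|n] c u v; first by rewrite scaler0 addr0.
by rewrite linearP scalerDr !scalerA mulrC.
Qed.
HB.instance Definition _ g p :=
  GRing.isLinear.Build C fock fock *:%R (@Eminus R D g p) (Eminus_is_linear g p).

Lemma Eplus_is_linear g p : linear (@Eplus R D g p).
Proof.
apply: ser_exp_is_linear => -[|n] c u v; first by rewrite scaler0 addr0.
by rewrite linearP scalerDr !scalerA mulrC.
Qed.
HB.instance Definition _ g p :=
  GRing.isLinear.Build C fock fock *:%R (@Eplus R D g p) (Eplus_is_linear g p).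

Lemma Yexp_is_linear g n : linear (@Yexp R D g n).
Proof. exact: lext_is_linear. Qed.
HB.instance Definition _ g n :=
  GRing.isLinear.Build C fock fock *:%R (@Yexp R D g n) (Yexp_is_linear g n).

Definition eventually0 (W : zmodType) (f : nat -> W) := exists J, forall j, (J <= j)%N -> f j = 0.

(** A sum over nat with infinite support is 0 by convention, so additivity needs
    both families to be eventually zero. *)
Lemma fsum_linear (W : lmodType C) c (f g k : nat -> W) : eventually0 f -> eventually0 g ->
  (forall j, k j = c *: f j + g j) ->
  (\sum_(j \in [set: nat]) k j = c *: (\sum_(j \in [set: nat]) f j)
    + \sum_(j \in [set: nat]) g j)%R.
Proof.
move=> [J f0] [L g0] E.
rewrite !(@fsbig_nat_trunc _ _ (maxn J L)).
- by rewrite scaler_sumr -big_split; apply: eq_bigr.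
- by move=> j; rewrite geq_max => /andP[_ /g0].
- by move=> j; rewrite geq_max => /andP[/f0].
by move=> j; rewrite geq_max E => /andP[/f0-> /g0->]; rewrite scaler0 addr0.
Qed.

Lemma heis_trunc u w : eventually0 (fun j => heis u j%:Z w).
Proof.
elim/fock_ind: w => [|c m i v [J E]]; first by exists 0%N => j _; rewrite linear0.
exists (maxn J (seqwt (gens m)).+1) => j; rewrite geq_max => /andP[Jj mj].
rewrite heis_is_linear E // addr0; have := bihom_heis u j%:Z (bihom_vec m i).
by move/bihom_lt0 ->; [rewrite scaler0 | lia].
Qed.

Lemma Eplus_trunc g w : eventually0 (fun q => Eplus g q w).
Proof.
elim/fock_ind: w => [|c m i v [J E]]; first by exists 0%N => j _; rewrite linear0.
exists (maxn J (seqwt (gens m)).+1) => j; rewrite geq_max => /andP[Jj mj].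
rewrite Eplus_is_linear E // addr0; have := @graded_Eplus g j _ _ _ (bihom_vec m i).
by move/bihom_lt0 ->; [rewrite scaler0 | lia].
Qed.

Lemma linear_fun0 (f : fock -> fock) : linear f -> f 0 = 0.
Proof. by move=> lf; have := lf (-1) 0 0; rewrite scaler0 addr0 scaleN1r addNr. Qed.

Lemma linear_trunc (f : int -> fock -> fock) : (forall n, linear (f n)) ->
  (forall m i, exists N : int, forall n, N <= n -> f n (vec m i) = 0) ->
  forall w, exists N : int, forall n, N <= n -> f n w = 0.
Proof.
move=> lf fv w; have f0 n : f n 0 = 0 := linear_fun0 (lf n).
elim/fock_ind: w => [|c m i v [N E]]; first by exists 0 => n _; rewrite f0.
have [N' E'] := fv m i; exists (Num.max N N') => n.
by rewrite ge_max => /andP[/E Ev /E' Em]; rewrite lf Ev Em scaler0 addr0.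
Qed.

(** Linearity for a list gives truncation for the same list, and truncation is what
    makes the sums for a longer list linear: the two are proved in alternation. *)
Lemma Ynop_trunc_of_linear l g : (forall n, linear (@Ynop R D l g n)) ->
  forall w, exists N : int, forall n, N <= n -> Ynop l g n w = 0.
Proof.
move=> lY; apply: linear_trunc => // m i.
exists ((seqwt (gens m))%:Z + (seqwt l)%:Z - zpow g i) => n nN.
by apply: bihom_lt0 (bihom_Ynop l g n (bihom_vec m i)); lia.
Qed.

Lemma Ynop_is_linear l g n : linear (@Ynop R D l g n).
Proof.
elim: l n => [|[s k] l lY] n; first exact: lext_is_linear.
have tY := Ynop_trunc_of_linear lY.
have Y0 p : Ynop l g p 0 = 0 := linear_fun0 (lY p).
have ev1 w : eventually0 (fun j => 'C(j + k, k)%:R *: heis (simple s) (- (j + k).+1%:Z) (Ynop l g (n + j%:Z) w)).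
  have [N E] := tY w; exists (absz (N - n)); move=> j jN.
  rewrite E ?linear0 ?scaler0 //.
  by lia.
have ev2 w : eventually0 (fun j => ((-1) ^+ k * 'C(j + k, k)%:R)
     *: Ynop l g (n - (j + k).+1%:Z) (heis (simple s) j%:Z w)).
  have [J E] := heis_trunc (simple s) w; exists J => j /E ->.
  by rewrite Y0 scaler0.
move=> c u v /=; rewrite scalerDr addrACA; congr (_ + _).
  apply: fsum_linear => // j; first by rewrite lY linearP scalerDr !scalerA (mulrC c).
by apply: fsum_linear => // j; rewrite linearP lY scalerDr !scalerA (mulrC c).
Qed.

HB.instance Definition _ l g n :=
  GRing.isLinear.Build C fock fock *:%R (@Ynop R D l g n) (Ynop_is_linear l g n).

Lemma Ynop_trunc l g w : exists N : int, forall n, N <= n -> Ynop l g n w = 0.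
Proof. exact/Ynop_trunc_of_linear/Ynop_is_linear. Qed.

(** The two sums in the recursion for Ynop, with their supports made explicit. *)
(** The second cut-off J1 depends on w alone, while the first one depends on the mode n:
    this lets the second sum be treated as a fixed finite combination of distributions. *)
Lemma Ynop_cons s k l g w : exists J1, forall n, exists J0, forall J, (J0 <= J)%N ->
  Ynop ((s, k) :: l) g n w =
    \sum_(j < J) 'C(j + k, k)%:R *: heis (simple s) (- (j + k).+1%:Z) (Ynop l g (n + j%:Z) w)
    + \sum_(j < J1.+1) ((-1) ^+ k * 'C(j + k, k)%:R)
         *: Ynop l g (n - (j + k).+1%:Z) (heis (simple s) j%:Z w).
Proof.
have [N E] := Ynop_trunc l g w; have [J1 E'] := heis_trunc (simple s) w.
exists J1 => n; exists (absz (N - n)) => J NJ /=; congr (_ + _).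
  by apply: fsbig_nat_trunc => j jJ; rewrite E ?linear0 ?scaler0 //; lia.
by apply: fsbig_nat_trunc => j jJ; rewrite (E' _ (ltnW jJ)) ?linear0 ?scaler0.
Qed.

End Gen.
End Homogeneity.

(** * The power series exp (x log (1 + z)) and distributions in 1/z *)

Section Scalars.
Variable F : numFieldType.
Implicit Types (x : F) (f g : int -> F) (n u : int).

Fixpoint gbin x p : F :=
  if p is q.+1 then gbin x q * (x - q%:R) / q.+1%:R else 1.

Lemma gbinS x p : gbin (x + 1) p.+1 = gbin x p.+1 + gbin x p.
Proof.
elim: p => [|p IH]; first by rewrite /= !subr0 !mul1r !divr1.
have p1 : p.+1%:R != 0 :> F by rewrite pnatr_eq0.
have p2 : p.+2%:R != 0 :> F by rewrite pnatr_eq0.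
rewrite [LHS]/= -/(gbin (x + 1) p.+1) IH [gbin x p.+2]/= -/(gbin x p.+1).
have E : gbin x p * (x - p%:R) = gbin x p.+1 * p.+1%:R by rewrite /= mulfVK.
have -> : x + 1 - p.+1%:R = x - p%:R by rewrite -(natr1 p); ring.
apply: (mulIf p2); rewrite mulfVK // [RHS]mulrDl mulfVK // [LHS]mulrDl E.
by rewrite -(natr1 p.+1) -(natr1 p); ring.
Qed.

Lemma gbin_nat N p : gbin N%:R p = 'C(N, p)%:R.
Proof.
elim: N p => [|N IH] [|p]; rewrite ?bin0 //.
  by elim: p => [|p IHp]; [rewrite /= subrr mulr0 mul0r | rewrite [LHS]/= -/(gbin 0 p.+1) IHp !mul0r].
by rewrite -natr1 gbinS !IH binS natrD.
Qed.

(** The coefficients of x log (1 + z). *)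
Definition logcoef x n : F := if n is k.+1 then (-1) ^+ k * x / k.+1%:R else 0.

Section ExpLog.
Variables (x : F) (p : nat).
Let P := \poly_(n < p.+1) logcoef x n.
Let E := \sum_(j < p.+1) (j`!%:R)^-1 *: P ^+ j.

Lemma coef_pow_lt j i : (i < j)%N -> (P ^+ j)`_i = 0.
Proof.
have P0 : P`_0 = 0 by rewrite coef_poly.
elim: j i => // j IH i ij; rewrite exprS coefM big1 // => k _.
case: k => -[|k] kP /=; first by rewrite P0 mul0r.
by rewrite IH ?mulr0 //; lia.
Qed.

(** P is x log (1 + z) truncated after z^p, so (1 + z) P' = x up to order p. *)
Lemma mul1X_deriv_log : exists q, (1 + 'X) * P^`() = x%:P + 'X^p * q.
Proof.
exists (- (-1) ^+ p * x)%:P; apply/polyP => i.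
rewrite mulrDl mul1r !coefD coefXM !coef_deriv coefC (mulrC 'X^p) coefMXn coefC.
have c k : P`_k.+1 *+ k.+1 = if (k < p)%N then (-1) ^+ k * x else 0.
  rewrite coef_poly ltnS; case: ltnP => _; last by rewrite mul0rn.
  by rewrite -mulr_natr [logcoef _ _]/= mulfVK // pnatr_eq0.
rewrite !c; case: i => [|i] /=.
  by case: (p) => [|q] /=; rewrite ?subn0 ?expr0 ?mul1r ?addr0 //; ring.
case: (ltngtP i.+1 p) => ip.
- by rewrite exprS; ring.
- by rewrite subn_eq0 leqNgt ip !addr0.
by rewrite -ip subnn eqxx exprS; ring.
Qed.

(** E = exp P satisfies (1 + z) E' = x E up to order p, which is the recursion
    (i + 1) E_(i+1) = (x - i) E_i of the generalised binomials. *)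
Lemma coef_explog i : (i <= p)%N -> E`_i = gbin x i.
Proof.
have EM j : (0 < j)%N -> (j`!%:R)^-1 *+ j = (j.-1`!%:R)^-1 :> F.
  case: j => // j _; rewrite factS natrM invfM -[LHS]mulr_natr mulrAC mulVf ?mul1r //.
  by rewrite pnatr_eq0.
have dE : exists r, E^`() = P^`() * (E + 'X^p * r).
  have [r Er] : exists r, P ^+ p = 'X^p * r.
    exists (drop_poly p (P ^+ p)); rewrite mulrC -[LHS](poly_take_drop p).
    rewrite (_ : take_poly _ _ = 0) ?add0r //.
    by apply/polyP => k; rewrite coef_take_poly coef0; case: ltnP => // /coef_pow_lt.
  exists (- (p`!%:R)^-1 *: r); rewrite -scalerAr -Er scaleNr.
  rewrite {2}/E big_ord_recr /= addrK mulr_sumr.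
  rewrite /E raddf_sum big_ord_recl /= expr0 derivZ derivC scaler0 add0r.
  apply: eq_bigr => j _; rewrite derivZ deriv_exp /= -scalerMnr scalerMnl EM //.
  by rewrite scalerAr.
have [q Eq] := mul1X_deriv_log; have [r Er] := dE.
elim: i => [|i IH] ip.
  rewrite coef_sum big_ord_recl /= expr0 fact0 invr1 scale1r coef1 big1 ?addr0 //.
  by move=> j _; rewrite coefZ coef_pow_lt ?mulr0.
have := congr1 (fun s : {poly F} => s`_i) (congr1 ( *%R (1 + 'X)) Er).
rewrite mulrA Eq /=.
have -> : (x%:P + 'X^p * q) * (E + 'X^p * r) =
    x%:P * E + 'X^p * (x%:P * r + q * (E + 'X^p * r)) by ring.
rewrite coefD coefCM coefXnM ip addr0 mulrDl mul1r coefD coefXM !coef_deriv.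
have {}IH := IH (ltnW ip); rewrite IH => eqE.
have p1 : i.+1%:R != 0 :> F by rewrite pnatr_eq0.
apply: (mulIf p1); rewrite /= mulfVK // mulr_natr mulrBr (mulrC _ x) -eqE.
case: i {ip eqE p1} IH => [|i] IH /=; first by rewrite mulr0 subr0 addr0.
by rewrite IH [in RHS]mulr_natr addrK.
Qed.
End ExpLog.

(** A sequence f stands for the formal distribution f(z) = sum f n z^(-n-1); the next
    two operators are multiplication by 1 + z and by z^-d. *)
Definition mul1z f n := f n + f (n + 1).
Definition shiftz (d : nat) f n := f (n - d%:Z).

Lemma iter_mul1zE W f n :
  iter W mul1z f n = \sum_(i < W.+1) 'C(W, i)%:R * f (n + i%:Z).
Proof.
elim: W n => [|W IH] n; first by rewrite big_ord1 mul1r addr0.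
rewrite /= /mul1z !IH [in RHS]big_ord_recl /= bin0.
rewrite [in RHS](eq_bigr (fun i : 'I_W.+1 => 'C(W, i.+1)%:R * f (n + i.+1%:Z)
    + 'C(W, i)%:R * f (n + 1 + i%:Z))); last first.
  move=> i _; rewrite (_ : n + 1 + i%:Z = n + (lift ord0 i)%:Z) /=; last by rewrite /bump; lia.
  by rewrite binS natrD mulrDl.
rewrite big_split /= addrA; congr (_ + _).
rewrite big_ord_recl /= bin0; congr (_ + _).
by rewrite [RHS]big_ord_recr /= bin_small // mul0r addr0.
Qed.

Lemma iter_mul1z_eq W f g : f =1 g -> iter W mul1z f =1 iter W mul1z g.
Proof. by move/funext->. Qed.

Lemma iter_mul1z_lin W c f g n :
  iter W mul1z (fun n => c * f n + g n) n = c * iter W mul1z f n + iter W mul1z g n.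
Proof.
rewrite !iter_mul1zE mulr_sumr -big_split; apply: eq_bigr => i _ /=.
by rewrite mulrDr mulrCA.
Qed.

Lemma iter_mul1z_scale W c f n :
  iter W mul1z (fun n => c * f n) n = c * iter W mul1z f n.
Proof. by rewrite !iter_mul1zE mulr_sumr; apply: eq_bigr => i _; rewrite mulrCA. Qed.

Lemma iter_mul1z_sum W (I : Type) (r : seq I) (f : I -> int -> F) (c : I -> F) n :
  iter W mul1z (fun n => \sum_(i <- r) c i * f i n) n =
  \sum_(i <- r) c i * iter W mul1z (f i) n.
Proof.
rewrite iter_mul1zE (eq_bigr (fun j : 'I_W.+1 =>
  \sum_(i <- r) c i * ('C(W, j)%:R * f i (n + j%:Z)))); last first.
  by move=> j _; rewrite mulr_sumr; apply: eq_bigr => i _; rewrite mulrCA.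
by rewrite exchange_big; apply: eq_bigr => i _; rewrite -mulr_sumr iter_mul1zE.
Qed.

Lemma iter_mul1z_shift W d f n :
  iter W mul1z (shiftz d f) n = shiftz d (iter W mul1z f) n.
Proof.
rewrite /shiftz !iter_mul1zE; apply: eq_bigr => i _; congr (_ * f _); lia.
Qed.

(** g is f divided by (1 + z)^(k+1), expanded in powers of z: multiplying back
    recovers f.  Each step lowers k by Pascal's rule. *)
Lemma iter_mul1z_inv k f g :
  (forall n, exists J0, forall J, (J0 <= J)%N ->
     g n = \sum_(j < J) (-1) ^+ j * 'C(j + k, k)%:R * f (n + j%:Z)) ->
  iter k.+1 mul1z g =1 f.
Proof.
elim: k f g => [|k IH] f g Eg n.
  rewrite /= /mul1z; have [J0 E0] := Eg n; have [J1 E1] := Eg (n + 1).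
  rewrite (E0 (J0 + J1).+1) ?(E1 (J0 + J1)%N); [|lia|lia].
  rewrite big_ord_recl /= addn0 bin0 mulr1 mul1r addr0 -addrA -big_split /=.
  rewrite big1 ?addr0 // => j _; rewrite !bin0 !mulr1 exprS.
  rewrite (_ : n + 1 + j%:Z = n + (1 + j)%N%:Z); [by rewrite mulN1r mulNr addNr | by lia].
rewrite iterSr; apply: IH => {}n.
have [J0 E0] := Eg n; have [J1 E1] := Eg (n + 1).
exists (J0 + J1).+1 => -[//|J] JJ; rewrite /mul1z (E0 J.+1) ?(E1 J); [|lia|lia].
rewrite !big_ord_recl /= !binn !mul1r addr0 -addrA -big_split /=; congr (_ + _).
apply: eq_bigr => j _; rewrite /bump /= (_ : n + 1 + j%:Z = n + (1 + j)%N%:Z); last by lia.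
rewrite -mulrDl; congr (_ * _); rewrite add1n !addSn !addnS binS natrD exprS; ring.
Qed.

(** The expansion of f(z) in powers of 1/z begins with t z^(-u-1). *)
Definition starts u t f := (forall n, n < u -> f n = 0) /\ f u = t.

Lemma starts_shift u t d f : (0 < d)%N -> starts u t f -> starts u 0 (shiftz d f).
Proof. by move=> d0 [f0 _]; split=> [n nu|]; apply: f0; lia. Qed.

(** Multiplication by (1 + 1/z)^d leaves the leading term in 1/z unchanged. *)
Lemma starts_mul u t d f : starts u t f -> starts u t (iter d mul1z (shiftz d f)).
Proof.
move=> Hf; have s0 : shiftz 0 f =1 f by move=> n; rewrite /shiftz subr0.
elim: d => [|d [IH0 IHu]]; first by rewrite (funext s0).
have E n : iter d.+1 mul1z (shiftz d.+1 f) n =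
    iter d mul1z (shiftz d f) (n - 1) + iter d mul1z (shiftz d f) n.
  rewrite iterS {1}/mul1z !iter_mul1z_shift /shiftz; congr (iter d mul1z f _ + iter d mul1z f _); lia.
have lt1 n : n - 1 < n by lia.
split=> [n nu|]; rewrite E IH0 ?add0r ?IHu //; last exact: lt_trans nu.
exact: IH0.
Qed.

Lemma starts_lin u c t t' f g : starts u t f -> starts u t' g ->
  starts u (c * t + t') (fun n => c * f n + g n).
Proof.
by move=> [f0 <-] [g0 <-]; split=> // n nu; rewrite f0 // g0 // mulr0 addr0.
Qed.

Lemma starts_scale u c t f : starts u t f -> starts u (c * t) (fun n => c * f n).
Proof. by move=> [f0 <-]; split=> // n nu; rewrite f0 // mulr0. Qed.

Lemma starts_sum u (I : Type) (r : seq I) (c t : I -> F) (f : I -> int -> F) :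
  (forall i, starts u (t i) (f i)) ->
  starts u (\sum_(i <- r) c i * t i) (fun n => \sum_(i <- r) c i * f i n).
Proof.
move=> Hf; split=> [n nu|]; last by apply: eq_bigr => i _; rewrite (Hf i).2.
by apply: big1 => i _; rewrite (Hf i).1 // mulr0.
Qed.

(** The distribution z^(-K-1) (1 + z)^x. *)
Definition binseq x (K : int) n : F := if K - n is Posz p then gbin x p else 0.

Lemma mul1z_binseq x K : mul1z (binseq x K) =1 binseq (x + 1) K.
Proof.
move=> n; rewrite /mul1z /binseq.
case E : (K - n) => [p|p].
  case: p E => [|p] E.
    by rewrite (_ : K - (n + 1) = Negz 0) ?addr0 //; lia.
  rewrite (_ : K - (n + 1) = Posz p); last by lia.
  by rewrite [RHS]gbinS.
by rewrite (_ : K - (n + 1) = Negz p.+1) ?addr0 //; lia.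
Qed.

Lemma iter_mul1z_binseq W x K : iter W mul1z (binseq x K) =1 binseq (x + W%:R) K.
Proof.
elim: W x => [|W IH] x n; first by rewrite addr0.
rewrite iterSr (iter_mul1z_eq _ (mul1z_binseq x K)) IH -natr1.
by congr (binseq _ _ _); ring.
Qed.

Lemma starts_binseq N K u : u <= K - N%:Z ->
  starts u (u == K - N%:Z)%:R (binseq N%:R K).
Proof.
move=> uK; split=> [n nu|]; rewrite /binseq.
  by case E : (K - n) => [p|//]; rewrite gbin_nat bin_small //; lia.
case E : (K - u) => [p|p]; last by lia.
rewrite gbin_nat; case: eqP => uE.
  by rewrite (_ : p = N) ?binn //; lia.
by rewrite bin_small //; lia.
Qed.

End Scalars.
Arguments mul1z {F} f n.
Arguments shiftz {F} d f n.

(** * Lowest weight functionals on V_{A_2} *)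

Section Coherent.
Context {R : realType}.
Local Notation C := R[i].
Local Notation h := 'rV[C]_2.
Notation gen := ('I_2 * nat)%type.
Notation hmon := {cmonom gen}.
Local Notation VA2 := (fock (dataA2 (R:=R))).

Section HeisVec.
Variable D : latdata (R:=R).

Lemma heis0_vec u m i : @heis R D u 0 (vec m i) = pair_form u (mu i) *: vec m i.
Proof. exact: lext_vec. Qed.

Lemma heisP_vec u k m i : @heis R D u k.+1%:Z (vec m i) =
  \sum_(s < 2) (k.+1%:R * pair_form u (simple s) * (m (s, k))%:R)
                     *: vec (divcm m (ucm (s, k))) i.
Proof. exact: lext_vec. Qed.

Lemma heisN_vec u k m i : @heis R D u (- k.+1%:Z) (vec m i) =
  \sum_(s < 2) u 0 s *: vec (mulcm m (ucm (s, k))) i.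
Proof. exact: lext_vec. Qed.

(** If f turns the operators A n into the scalars of x log (1 + z), then it turns their
    exponential into (1 + z)^x. *)
Lemma scalar_ser_exp (f : {scalar fock D}) (A : opser D) (x : C) :
  (forall n w, f (A n w) = logcoef x n * f w) ->
  forall p w, f (ser_exp A p w) = gbin x p * f w.
Proof.
move=> fA p w; pose P := \poly_(n < p.+1) logcoef x n.
have fpow j i : (i <= p)%N ->
    f (iter j (ser_mul A) (@ser_one R D) i w) = (P ^+ j)`_i * f w.
  elim: j i => [|j IH] i ip.
    by rewrite expr0 coef1; case: i ip => [|i] _ /=; rewrite ?mul1r // mul0r linear0.
  rewrite iterS /ser_mul linear_sum exprS coefM mulr_suml; apply: eq_bigr => k _.
  have ki : (k <= i)%N by rewrite -ltnS.
  rewrite fA IH ?mulrA; last by rewrite (leq_trans (leq_subr _ _)).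
  by rewrite coef_poly ltnS (leq_trans ki).
rewrite /ser_exp linear_sum -(@coef_explog _ x p) // coef_sum mulr_suml.
by apply: eq_bigr => j _; rewrite linearZ /= fpow // coefZ mulrA.
Qed.
End HeisVec.

Variable v : 'I_2 -> C.

(** For v s = (gamma_s|mu), this is the zero mode of d^(k) gamma_s(z) on e^mu, where
    only gamma_s(0) z^-1 contributes and d^(k) z^-1 = (-1)^k z^(-k-1). *)
Definition chi_gen (x : gen) : C := (-1) ^+ x.2 * v x.1.
Definition chi (m : hmon) : C := \prod_(x <- gens m) chi_gen x.

(** Up to the cocycle, the scalar by which the zero mode of w maps e^mu to e^(mu + g), if
    both vectors have lowest weight. *)
Definition phi (g : A2) (w : VA2) : C :=
  malg_lift (fun k => (k.2 == g)%:R * chi k.1 : C^o) w.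

Lemma phi_is_scalar g : scalar (phi g).
Proof. exact: malg_lift_is_linear. Qed.
HB.instance Definition _ g := GRing.isLinear.Build C VA2 C *%R (phi g) (phi_is_scalar g).

Lemma phi_vec g m g' : phi g (@vec R dataA2 m g') = (g' == g)%:R * chi m.
Proof. exact: (malg_liftU (W := C^o) (fun k => (k.2 == g)%:R * chi k.1 : C^o) (m, g')). Qed.

Lemma phi_bihom (g : A2) (e : int) (g' : A2) (w : VA2) :
  g' != g -> @bihom R dataA2 e g' w -> phi g w = 0.
Proof.
move=> gg' Hw; rewrite /phi /malg_lift big_seq big1 // => k kw.
have [_ ->] := Hw k (etrans (mcoeff_neq0 _ _) kw).
by rewrite (negbTE gg') mul0r scaler0.
Qed.

Lemma chiM m x : chi (mulcm m (ucm x)) = chi_gen x * chi m.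
Proof. by rewrite /chi (perm_big _ (gensM m x)) big_cons. Qed.

(** (u|mu), if v is as above. *)
Definition dotv (u : h) : C := \sum_(s < 2) u 0 s * v s.

(** phi is a left eigenvector of the creation operators: this is what sums the
    vertex operator Y(a,z)b to a rational function of z. *)
Lemma phi_create g u k w :
  phi g (heis u (- k.+1%:Z) w) = (-1) ^+ k * dotv u * phi g w.
Proof.
elim/(@fock_ind R dataA2): w => [|c m i w IH]; first by rewrite !linear0 mulr0.
rewrite heis_is_linear !phi_is_scalar mulrDr; congr (_ + _); last exact: IH.
rewrite heisN_vec linear_sum phi_vec mulrCA; congr (c * _).
rewrite -mulrA [dotv u * _]mulrC mulrA /dotv mulr_sumr; apply: eq_bigr => s _.
rewrite linearZ /= phi_vec chiM /chi_gen /=; ring.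
Qed.

Lemma phi_heis0 g u w : phi g (heis u 0 w) = pair_form u (emb g) * phi g w.
Proof.
elim/(@fock_ind R dataA2): w => [|c m i w IH]; first by rewrite !linear0 mulr0.
rewrite heis_is_linear !phi_is_scalar mulrDr; congr (_ + _); last exact: IH.
rewrite heis0_vec linearZ /= phi_vec.
by case: eqP => [->|_]; rewrite ?mul0r ?mulr0 // mulrCA.
Qed.

Lemma phi_Eminus g g' p w : phi g (Eminus g' p w) = gbin (dotv (emb g')) p * phi g w.
Proof.
apply: scalar_ser_exp => -[|n] {}w; first by rewrite linear0 mul0r.
by rewrite linearZ /= phi_create mulrA; congr (_ * _); rewrite mulrC.
Qed.

Definition halfnorm (g : A2) : nat := `|pair_form g g|./2%N.

Section Residue.
Variables (g g' : A2) (N : nat).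
Hypothesis dotN : dotv (emb g) + (halfnorm g)%:R = N%:R.
Let u := - pair_form g g' - 1 - N%:Z.

Lemma phi_Yexp m : exists Q, forall n,
  phi (g + g') (Yexp g n (@vec R dataA2 m g')) =
  \sum_(q < Q.+1) (eps g g' * phi (g + g') (Eplus g q (@vec R dataA2 m (g + g'))))
    * binseq (dotv (emb g)) (q%:Z - pair_form g g' - 1) n.
Proof.
have [Q EQ] := Eplus_trunc g (@vec R dataA2 m (g + g')); exists Q => n.
rewrite /Yexp lext_vec (@fsbig_nat_trunc _ _ Q.+1) => [|q /ltnW/EQ Eq]; last first.
  by case: (_ - _) => // p; rewrite linearZ /= Eq scaler0 linear0.
rewrite linear_sum; apply: eq_bigr => q _; rewrite /binseq /=.
rewrite (_ : q%:Z - pair_form g g' - 1 - n = q%:Z - pair_form g g' - n - 1); last by ring.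
case: (_ - _) => p; last by rewrite linear0 mulr0.
by rewrite phi_Eminus !linearZ /= mulrC.
Qed.

(** After multiplication by (1 + z)^(g|g)/2, the annihilation part E^+ contributes
    only powers z^-q, and the factor (1 + z)^N is a polynomial because N is a natural
    number; the leading term is that of q = 0. *)
Lemma phi_Yexp_starts b :
  starts u (eps g g' * phi g' b)
    (iter (halfnorm g) mul1z (fun n => phi (g + g') (Yexp g n b))).
Proof.
elim/(@fock_ind R dataA2): b => [|c m i b IH].
  rewrite linear0 mulr0; split=> [n _|]; rewrite iter_mul1zE big1 // => j _;
  by rewrite !linear0 mulr0.
have -> : (fun n => phi (g + g') (Yexp g n (c *: vec m i + b))) =
    (fun n => c * phi (g + g') (Yexp g n (vec m i)) + phi (g + g') (Yexp g n b)).
  by apply/funext => n; rewrite Yexp_is_linear phi_is_scalar.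
rewrite (funext (iter_mul1z_lin _ _ _ _)) phi_is_scalar mulrDr mulrCA.
apply: starts_lin; last exact: IH.
have [->|ig'] := eqVneq i g'; last first.
  rewrite phi_vec (negbTE ig') mul0r mulr0.
  have H n : phi (g + g') (Yexp g n (vec m i)) = 0.
    apply: phi_bihom (@bihom_Yexp R dataA2 g n _ _ _ (@bihom_vec R dataA2 m i)).
    by apply: contraNneq ig' => /addrI ->.
  by rewrite (funext H); split=> [n _|]; rewrite iter_mul1zE big1 // => j _; rewrite mulr0.
have [Q EQ] := phi_Yexp m; rewrite (funext EQ).
rewrite (funext (iter_mul1z_sum _ _ _ _)).
have -> : eps g g' * phi g' (@vec R dataA2 m g') = \sum_(q < Q.+1)
   (eps g g' * phi (g + g') (Eplus g q (@vec R dataA2 m (g + g')))) * ((q : nat) == 0%N)%:R.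
  rewrite big_ord_recl mulr1 big1 => [|q _]; last by rewrite mulr0.
  by rewrite addr0 /Eplus /ser_exp big_ord1 /= fact0 invr1 scale1r !phi_vec !eqxx.
apply: starts_sum => q; rewrite (funext (iter_mul1z_binseq _ _ _)) dotN.
rewrite (_ : (q : nat) == 0%N = (u == q%:Z - pair_form g g' - 1 - N%:Z)).
  by apply: starts_binseq; rewrite /u; lia.
by apply/eqP/eqP; rewrite /u; lia.
Qed.

(** One more generator gamma_s(-k-1) brings k + 1 more factors 1 + z.  They turn its
    creation part, a multiple of (1 + z)^(-k-1), into a scalar, and its annihilation
    part gamma_s(j) z^(-j-k-1) into (1 + 1/z)^(k+1) z^-j, so that only j = 0 reaches the
    leading term; together they give (-1)^k (gamma_s|mu + g'). *)
Lemma phi_Ynop_starts l b :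
  starts u (eps g g' * \prod_(x <- l)
      ((-1) ^+ x.2 * (v x.1 + pair_form (simple x.1) (emb g'))) * phi g' b)
    (iter (seqwt l + halfnorm g) mul1z (fun n => phi (g + g') (Ynop l g n b))).
Proof.
elim: l b => [|[s k] l IH] b.
  by rewrite /seqwt !big_nil mulr1; apply: phi_Yexp_starts.
have [J EJ] := Ynop_cons s k l g b.
pose F b n := phi (g + g') (Ynop l g n b).
(* G is the annihilation part and H the creation part of the new field. *)
pose G := fun n => \sum_(j < J.+1) ((-1) ^+ k * 'C(j + k, k)%:R)
  * shiftz (j + k).+1 (F (heis (simple s) j%:Z b)) n.
pose H := fun n => phi (g + g') (Ynop ((s, k) :: l) g n b) - G n.
have HE : iter k.+1 mul1z H =1 (fun n => (-1) ^+ k * v s * F b n).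
  apply: iter_mul1z_inv => n; have [J0 E0] := EJ n; exists J0 => J' /E0 E.
  rewrite /H E; apply/eqP; rewrite subr_eq; apply/eqP; rewrite linearD !linear_sum.
  congr (_ + _); apply: eq_bigr => j _; last exact: linearZ.
  rewrite linearZ /= phi_create exprD.
  rewrite (_ : dotv (simple s) = v s); first by rewrite /F; ring.
  rewrite /dotv (bigD1 s) //= big1 => [|i /negbTE si]; rewrite !mxE ?eqxx ?mul1r ?addr0 //.
  by rewrite si mul0r.
have -> : (fun n => phi (g + g') (Ynop ((s, k) :: l) g n b)) = (fun n => 1 * G n + H n).
  by apply/funext => n; rewrite mul1r /H [RHS]addrC subrK.
rewrite (funext (iter_mul1z_lin _ _ _ _)) !big_cons /=.
set P := \prod_(x <- l) _ in IH *.
have -> : eps g g' * ((-1) ^+ k * (v s + pair_form (simple s) (emb g')) * P) * phi g' b =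
  1 * (\sum_(j < J.+1) ((-1) ^+ k * 'C(j + k, k)%:R) *
         (((j : nat) == 0%N)%:R * (eps g g' * P * phi g' (heis (simple s) j%:Z b)))) +
  (-1) ^+ k * v s * (eps g g' * P * phi g' b).
  rewrite big_ord_recl /= big1 => [|j _]; last by rewrite mul0r mulr0.
  by rewrite binn phi_heis0; ring.
have -> : (seqwt ((s, k) :: l) + halfnorm g = k.+1 + (seqwt l + halfnorm g))%N.
  by rewrite /seqwt big_cons addnA.
apply: starts_lin; last first.
  rewrite (addnC k.+1) iterD (funext HE) (funext (iter_mul1z_scale _ _ _)).
  exact/starts_scale/IH.
rewrite (funext (iter_mul1z_sum _ _ _ _)); apply: starts_sum => j.
rewrite iterD (funext (iter_mul1z_shift _ _ _)).
set X := iter _ mul1z (F _).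
have -> : shiftz (j + k).+1 X = shiftz k.+1 (shiftz j X).
  by apply/funext => n; rewrite /shiftz; congr (X _); lia.
apply: starts_mul; have [j0|j0] := eqVneq (j : nat) 0%N.
  rewrite /X j0 mul1r; have -> : forall f : int -> C, shiftz 0 f = f.
    by move=> f; apply/funext => n; rewrite /shiftz subr0.
  exact: IH.
by rewrite mul0r; apply: starts_shift (IH _); rewrite lt0n.
Qed.

End Residue.
End Coherent.

(** * Residues of Zhu's products *)

Section ZhuProducts.
Context {R : realType}.
Local Notation C := R[i].
Local Notation h := 'rV[C]_2.
Notation gen := ('I_2 * nat)%type.
Notation hmon := {cmonom gen}.
Local Notation VA2 := (fock (dataA2 (R:=R))).
Implicit Types (a b : VA2) (g : A2).

(** Res_z Y(a,z) b (1 + z)^(wt a) z^-r for a basis vector a. *)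
Definition zbasis (r : nat) (k : hmon * A2) b : VA2 :=
  \sum_(i < (wt k).+1) 'C(wt k, i)%:R *: Ybasis k.1 k.2 (i%:Z - r%:Z) b.

Lemma zresE r a b : zres r a b = malg_lift (fun k => zbasis r k b) a.
Proof. by []. Qed.

Lemma zres_vec r m g b : zres r (@vec R dataA2 m g) b = zbasis r (m, g) b.
Proof. exact: (@malg_liftU _ _ VA2 (fun k => zbasis r k b) (m, g)). Qed.

(** The pairings of mu + g with the simple roots, if v gives those of mu. *)
Definition shiftv (v : 'I_2 -> C) g (s : 'I_2) : C := v s + pair_form (simple s) (emb g).

(** v gives the pairings of a vector mu with the simple roots; in these terms the
    condition says that |mu + g|^2 - |mu|^2 is in 2N for all g, i.e. that mu belongs to
    the dual lattice and has minimal norm in mu + A_2. *)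
Definition minvec (v : 'I_2 -> C) :=
  forall g, exists N : nat, dotv v (emb g) + (halfnorm g)%:R = N%:R.

Lemma pair_formC (T : comNzRingType) (x y : 'rV[T]_2) : pair_form x y = pair_form y x.
Proof. by rewrite /pair_form; ring. Qed.

Lemma pair_formDr (T : comNzRingType) (x y z : 'rV[T]_2) :
  pair_form x (y + z) = pair_form x y + pair_form x z.
Proof. by rewrite /pair_form !mxE; ring. Qed.

Lemma pair_formNr (T : comNzRingType) (x y : 'rV[T]_2) :
  pair_form x (- y) = - pair_form x y.
Proof. by rewrite /pair_form !mxE; ring. Qed.

Lemma pair_formNl (T : comNzRingType) (x y : 'rV[T]_2) :
  pair_form (- x) y = - pair_form x y.
Proof. by rewrite pair_formC pair_formNr pair_formC. Qed.

Lemma sum_rV2 (T : comNzRingType) (f : 'I_2 -> T) : \sum_(s < 2) f s = f 0 + f 1.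
Proof. by rewrite big_ord_recl big_ord1; congr (_ + f _); apply: val_inj. Qed.

Lemma pair_form_simple (s : 'I_2) (x : h) : pair_form (simple s) x = x 0 s *+ 3 - (x 0 0 + x 0 1).
Proof.
have [->|->] : s = 0 \/ s = 1.
  by case: s => -[|[|//]] i; [left|right]; apply: val_inj.
all: rewrite /pair_form !mxE !eqxx /=; ring.
Qed.

Lemma dotv_form (x y : h) : dotv (fun s => pair_form (simple s) y) x = pair_form x y.
Proof. rewrite /dotv sum_rV2 !pair_form_simple /pair_form; ring. Qed.

Lemma emb_form g g' : pair_form (emb g) (emb g') = (pair_form g g')%:~R :> C.
Proof. by rewrite /pair_form !mxE !(rmorphB, rmorphD, rmorphMn, rmorphM). Qed.

Lemma halfnormE g : pair_form g g = (halfnorm g)%:Z *+ 2.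
Proof.
have E : pair_form g g = (g 0 0 ^+ 2 + g 0 1 ^+ 2 - g 0 0 * g 0 1) *+ 2.
  by rewrite /pair_form; ring.
have ge0 : 0 <= g 0 0 ^+ 2 + g 0 1 ^+ 2 - g 0 0 * g 0 1 by nia.
rewrite /halfnorm E; lia.
Qed.

Lemma halfnormN g : halfnorm (- g) = halfnorm g.
Proof. by rewrite /halfnorm pair_formNr pair_formNl opprK. Qed.

Lemma dotv_shiftv (v : 'I_2 -> C) g x : dotv (shiftv v g) x = dotv v x + pair_form x (emb g).
Proof.
rewrite -(dotv_form x) /dotv -big_split; apply: eq_bigr => s _ /=.
by rewrite mulrDr.
Qed.

Lemma dotvN (v : 'I_2 -> C) x : dotv v (- x) = - dotv v x.
Proof. by rewrite /dotv -sumrN; apply: eq_bigr => s _; rewrite mxE mulNr. Qed.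

Lemma embN g : emb (- g) = - emb g :> h.
Proof. by apply/rowP => i; rewrite !mxE rmorphN. Qed.

(** The exponent M = (g|g') + N is minus the amount N' by which |mu + g'|^2 / 2 exceeds
    |mu + g + g'|^2 / 2. *)
Lemma minvec_le (v : 'I_2 -> C) g g' N N' :
  dotv v (emb g) + (halfnorm g)%:R = N%:R ->
  dotv (shiftv v (g + g')) (emb (- g)) + (halfnorm (- g))%:R = N'%:R ->
  pair_form g g' + N%:Z + N'%:Z = 0.
Proof.
rewrite halfnormN dotv_shiftv embN dotvN pair_formNl emb_form => EN EN'.
move: EN'; rewrite pair_formDr halfnormE; move: (pair_form g g') => p EN'.
have : (p + N%:Z + N'%:Z)%:~R == 0 :> C.
  rewrite !rmorphD /= -!pmulrn -EN -EN' rmorphD /= rmorphMn /= -pmulrn.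
  by apply/eqP; ring.
by rewrite intr_eq0 => /eqP.
Qed.

Lemma phi_zbasis (v : 'I_2 -> C) r m g g' b :
  phi v (g + g') (zbasis r (m, g) b) =
  iter (seqwt (gens m) + halfnorm g) mul1z
    (fun n => phi v (g + g') (Ynop (gens m) g n b)) (- r%:Z).
Proof.
rewrite /zbasis wt_seqwt iter_mul1zE linear_sum; apply: eq_bigr => i _.
by rewrite linearZ /= /Ybasis (addrC i%:Z).
Qed.

Lemma chi_shiftv v g m :
  chi (shiftv v g) m =
  \prod_(x <- gens m) ((-1) ^+ x.2 * (v x.1 + pair_form (simple x.1) (emb g))).
Proof. by rewrite /chi; apply: eq_bigr. Qed.

(** The residue against z^-2 sees the coefficient of z^1, above the leading exponent. *)
Lemma phi_circ v g0 a b : minvec v -> minvec (shiftv v g0) -> phi v g0 (zhu_circ a b) = 0.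
Proof.
move=> mv mv'; rewrite /zhu_circ zresE /malg_lift linear_sum big1 // => -[m g] _.
rewrite linearZ /= (_ : g0 = g + (g0 - g)); last by rewrite addrC subrK.
have [N EN] := mv g; have [N' EN'] := mv' (- g).
rewrite (_ : g0 = g + (g0 - g)) in EN'; last by rewrite addrC subrK.
have M0 := minvec_le EN EN'.
rewrite phi_zbasis (@phi_Ynop_starts R v g (g0 - g) N EN (gens m) b).1 ?mulr0 //; lia.
Qed.

(** The residue against z^-1 sees the coefficient of z^0, which is the leading one
    exactly if the leading exponent is 0. *)
Lemma phi_star v m g g' N b : dotv v (emb g) + (halfnorm g)%:R = N%:R ->
  pair_form g g' + N%:Z <= 0 ->
  phi v (g + g') (zbasis 1 (m, g) b) =
    (pair_form g g' + N%:Z == 0)%:R * (eps g g' * chi (shiftv v g') m * phi v g' b).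
Proof.
move=> EN M0; have [S0 Su] := @phi_Ynop_starts R v g g' N EN (gens m) b.
rewrite phi_zbasis; have [Meq|Mne] := eqVneq.
  rewrite mul1r chi_shiftv -Su; congr (iter _ _ _ _); lia.
by rewrite mul0r S0 //; lia.
Qed.

End ZhuProducts.

(** * Vertex operators on lowest weight vectors *)

Section LowestWeight.
Context {R : realType}.
Local Notation C := R[i].
Notation gen := ('I_2 * nat)%type.
Notation hmon := {cmonom gen}.

Section Gen.
Variable D : latdata (R:=R).
Local Notation hw := (@vec R D (onecm gen)).
Implicit Types (i j : lab D) (w : fock D) (g : A2).

Lemma bihom0 i w : bihom 0 i w -> w = w@_(onecm gen, i) *: hw i.
Proof.
move=> Hw; apply/malgP => k; rewrite mcoeffZ vecE.
case: ((onecm gen, i) =P k) => [<-|ki]; first by rewrite mulr1.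
rewrite mulr0; apply/eqP/negPn/negP => /Hw [k1 k2]; apply: ki.
case: k k1 k2 => m j /= [/seqwt_gens0 ->] -> //.
Qed.

Lemma bihom_hw i : bihom 0 i (hw i).
Proof. by have := @bihom_vec R D (onecm gen) i; rewrite gens1 /seqwt big_nil. Qed.

Arguments bihom_hw : clear implicits.

Lemma heis_hw u k i : heis u k%:Z (hw i) = (k == 0%N)%:R * pair_form u (mu i) *: hw i.
Proof.
case: k => [|k]; first by rewrite heis0_vec mul1r.
rewrite mul0r scale0r; apply: bihom_lt0 (@bihom_heis R D u k.+1 0 i _ (bihom_hw i)).
by lia.
Qed.

Definition vac_coef0 i : set (fock D) := [set w | w@_(onecm gen, i) = 0]%classic.

Lemma vac_coef0_subspace i : subspace (vac_coef0 i).
Proof.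
split=> [|c u v Eu Ev]; rewrite /vac_coef0 /=; first by rewrite mcoeff0.
by rewrite mcoeffD mcoeffZ Eu Ev mulr0 addr0.
Qed.

Lemma vac_coef0_create u k i w : vac_coef0 i (heis u (- k.+1%:Z) w).
Proof.
apply: (subspace_lext (vac_coef0_subspace i)) => m j _.
apply: (subspace_sum (vac_coef0_subspace i)) => s _.
apply: (subspaceZ (vac_coef0_subspace i)); rewrite /vac_coef0 /= vecE.
case: eqP => // -[/(congr1 (fun m : hmon => m (s, k)))].
by rewrite mulcmE ucmE onecmE eqxx addn1.
Qed.

Lemma vac_coef0_Eminus g p i w : vac_coef0 i (Eminus g p.+1 w).
Proof.
have S := vac_coef0_subspace i.
apply: (subspace_sum S) => -[[|j] jp] _; apply: (subspaceZ S); first exact: subspace0.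
apply: (subspace_sum S) => -[[|l] lp] _; first exact: subspace0.
by apply: (subspaceZ S); exact: vac_coef0_create.
Qed.

Lemma ser_exp0 (A : opser D) w : ser_exp A 0 w = w.
Proof. by rewrite /ser_exp big_ord1 /= fact0 invr1 scale1r. Qed.

Lemma Yexp_hw g n j : Yexp g n (hw j) =
  if - zpow g j - n - 1 is Posz p then ecoef g j *: Eminus g p (hw (shift g j)) else 0.
Proof.
rewrite /Yexp lext_vec (@fsbig_nat_trunc _ _ 1) => [|[//|q] _]; last first.
  case: (_ - 1) => // p.
  have H : bihom 0 (shift g j) (ecoef g j *: hw (shift g j)).
    exact: (subspaceZ (bihom_subspace _ _) _ (bihom_hw _)).
  rewrite (_ : Eplus g q.+1 _ = 0) ?linear0 //.
  by apply: bihom_lt0 (@graded_Eplus R D g q.+1 _ _ _ H); lia.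
rewrite big_ord1 sub0r; case: (_ - 1) => // p.
by rewrite [Eplus g _ _]ser_exp0 linearZ.
Qed.

Lemma coef_Yexp_hw g n i j : (Yexp g n (hw j))@_(onecm gen, i) =
  ecoef g j *+ ((shift g j == i) && (zpow g j + n + 1 == 0)).
Proof.
rewrite Yexp_hw; case E : (_ - 1) => [[|p]|p].
- rewrite mcoeffZ [Eminus _ _ _]ser_exp0 vecE xpair_eqE eqxx /=.
  rewrite (_ : _ + _ == 0 = true) ?andbT ?mulr_natr //.
  by apply/eqP; lia.
- rewrite mcoeffZ vac_coef0_Eminus mulr0 (_ : _ + _ == 0 = false) ?andbF //.
  by apply/eqP; lia.
- rewrite mcoeff0 (_ : _ + _ == 0 = false) ?andbF //.
  by apply/eqP; lia.
Qed.

(** On e^mu every generator acts through its zero mode: the negative modes miss the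
    coefficient of e^mu', and the positive ones annihilate e^mu. *)
Lemma coef_Ynop_hw l g n i j : (Ynop l g n (hw j))@_(onecm gen, i) =
  (\prod_(x <- l) ((-1) ^+ x.2 * pair_form (simple x.1) (mu j)))
   * (Yexp g (n - (seqwt l)%:Z) (hw j))@_(onecm gen, i).
Proof.
elim: l n => [|[s k] l IH] n; first by rewrite /seqwt !big_nil mul1r subr0.
have [J1 EJ] := Ynop_cons s k l g (hw j); have [J0 E] := EJ n.
rewrite (E J0) // mcoeffD raddf_sum big1 => [|p _]; last first.
  by rewrite /= mcoeffZ vac_coef0_create mulr0.
rewrite add0r raddf_sum big_ord_recl big1 => [|p _]; last first.
  by rewrite /= heis_hw mul0r scale0r linear0 scaler0 mcoeff0.
rewrite /= addr0 heis_hw mul1r linearZ /= !mcoeffZ IH add0n binn mulr1.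
rewrite big_cons /seqwt big_cons /= PoszD opprD addrA; ring.
Qed.

(** This is how M(1,g), for g outside Z alpha, acts by zero on L. *)
Lemma Ynop_ecoef0 l g n w : (forall i, ecoef g i = 0) -> @Ynop R D l g n w = 0.
Proof.
move=> e0; elim: l n w => [|[s k] l IH] n w.
  rewrite /= /Yexp /lext big1 // => k _; rewrite fsbig1 ?scaler0 // => q _.
  by case: (_ - 1) => // p; rewrite e0 scale0r !linear0.
rewrite /= -[RHS]addr0; congr (_ + _); apply: fsbig1 => j _.
  by rewrite IH linear0 scaler0.
by rewrite IH scaler0.
Qed.

End Gen.
End LowestWeight.

(** * Zero modes on the bottom of L *)

Section Bottom.
Context {R : realType}.
Local Notation C := R[i].
Local Notation h := 'rV[C]_2.
Notation gen := ('I_2 * nat)%type.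
Notation hmon := {cmonom gen}.
Local Notation VA2 := (fock (dataA2 (R:=R))).

Variables (e : bool) (lam : h).
Local Notation D := (dataL e lam).
Local Notation L := (fock D).
Local Notation hw := (@vec R D (onecm gen)).
Implicit Types (g : A2) (n k : int) (a b : VA2) (w : L).

(** The weight of e^(n alpha + epsv) above the lowest one,
    (|n alpha + epsv|^2 - |epsv|^2) / 2. *)
Definition excess n : int := n * n + n *+ e.
Definition bottom_labels : seq int := if e then [:: 0; -1] else [:: 0].

Lemma excess_ge0 n : 0 <= excess n.
Proof. by rewrite /excess; case: e => /=; rewrite ?mulr1n ?mulr0n; nia. Qed.

Lemma bottom_labelsE n : (n \in bottom_labels) = (excess n == 0).
Proof.
rewrite /bottom_labels /excess; case: e; rewrite ?mulr1n ?mulr0n !inE; apply/idP/eqP.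
- by case/orP => /eqP ->.
- move=> H; apply/orP; have /eqP : n * (n + 1) = 0 by rewrite mulrDr mulr1.
  by rewrite mulf_eq0 => /orP[/eqP|/eqP] n0; [left|right]; apply/eqP; lia.
- by move/eqP ->.
by rewrite addr0 => /eqP; rewrite mulf_eq0 orbb.
Qed.

Lemma bottom_labels_uniq : uniq bottom_labels.
Proof. by rewrite /bottom_labels; case: e. Qed.

Lemma alphaE k (s : 'I_2) : (alpha *~ k : A2) 0 s = k *+ (s == 0).
Proof.
have -> : (alpha *~ k : A2) = k *: alpha.
  by rewrite -scaler_int intz.
by rewrite !mxE eqxx /= mulr_natr.
Qed.

Lemma alpha_eqE g k : (g == alpha *~ k) = (g 0 0 == k) && (g 0 1 == 0).
Proof.
apply/eqP/andP => [->|[/eqP g0 /eqP g1]].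
  by rewrite !alphaE !eqxx.
apply/rowP => s; rewrite alphaE.
have [->|->] : s = 0 \/ s = 1.
  by case: s => -[|[|//]] i; [left|right]; apply: val_inj.
  by rewrite eqxx.
by rewrite g1.
Qed.

Lemma excess_shift g n : g 0 1 = 0 ->
  (halfnorm g)%:Z + @zpow R D g n = excess (g 0 0 + n) - excess n.
Proof.
move=> g1; have := halfnormE g; rewrite /= /pair_form !alphaE g1 eqxx /= /excess.
move: (g 0 0) (halfnorm g) => k N; rewrite !mulrnDl /= !mulr0 !mul0r.
by case: e; rewrite ?mulr1n ?mulr0n; nia.
Qed.

Lemma ecoefL g n : @ecoef R D g n = (g 0 1 == 0)%:R.
Proof. by rewrite /=; case: eqP => //= g1; rewrite /eps g1 mul0r expr0z. Qed.

(** The pairings of the simple roots with n alpha + epsv + lam. *)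
Definition rootpair n (s : 'I_2) : C := pair_form (simple s) (@mu R D n).

Lemma Ybasis_hw m g n : n \in bottom_labels ->
  Ybasis m g ((wt (m, g))%:Z - 1) (hw n) =
  \sum_(i <- bottom_labels) ((g == alpha *~ (i - n))%:R * chi (rootpair n) m) *: hw i.
Proof.
rewrite bottom_labelsE => /eqP n0.
have [g1|g1] := eqVneq (g 0 1) 0; last first.
  rewrite /Ybasis Ynop_ecoef0 => [|i]; last by rewrite ecoefL (negbTE g1).
  rewrite big1 // => i _; rewrite alpha_eqE (negbTE g1) andbF mul0r scale0r //.
have Z := excess_shift n g1; rewrite n0 subr0 in Z.
have H : @bihom R D (- excess (g 0 0 + n)) (g 0 0 + n) (Ybasis m g ((wt (m, g))%:Z - 1) (hw n)).
  apply: bihom_eq (@bihom_Ynop R D (gens m) g _ _ _ _ (@bihom_hw R D n)) _.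
  by rewrite -Z wt_seqwt /= -/(halfnorm g); lia.
have E i : (g == alpha *~ (i - n)) = (i == g 0 0 + n).
  by rewrite alpha_eqE g1 eqxx andbT; apply/eqP/eqP; lia.
have [ib|ib] := boolP (g 0 0 + n \in bottom_labels); last first.
  rewrite (bihom_lt0 _ H); last first.
    by move: ib (excess_ge0 (g 0 0 + n)); rewrite bottom_labelsE; lia.
  rewrite big_seq big1 // => i ib'; rewrite E; case: eqP => [ii|_].
    by move: ib; rewrite -ii ib'.
  by rewrite mul0r scale0r.
move: (ib); rewrite bottom_labelsE => /eqP i0; rewrite i0 oppr0 in H.
rewrite (bigD1_seq _ ib bottom_labels_uniq) /= E eqxx mul1r big1 ?addr0 => [|i /negbTE ii]; last first.
  by rewrite E ii mul0r scale0r.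
apply: etrans (bihom0 H) _.
suff -> : (Ybasis m g ((wt (m, g))%:Z - 1) (hw n))@_(onecm gen, g 0 0 + n) = chi (rootpair n) m.
  by [].
rewrite /Ybasis (@coef_Ynop_hw R D) (@coef_Yexp_hw R D) ecoefL g1 eqxx /= eqxx /=.
rewrite (_ : (_ + _ == 0) = true) ?mulr1 //.
by apply/eqP; rewrite wt_seqwt /= -/(halfnorm g); move: Z; rewrite /= i0; lia.
Qed.

Lemma zmode_linl w : linear (fun a => zmode a w : L).
Proof. exact: malg_lift_is_linear. Qed.

Lemma zmode_linr a : linear (zmode a : L -> L).
Proof.
move=> c u v; rewrite /zmode scaler_sumr -big_split; apply: eq_bigr => k _ /=.
by rewrite /Ybasis Ynop_is_linear scalerDr !scalerA mulrC.
Qed.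

(** The zero mode preserves the weight, so only bottom vectors occur on the right. *)
Lemma zmode_hw a n : n \in bottom_labels ->
  zmode a (hw n) = \sum_(i <- bottom_labels) phi (rootpair n) (alpha *~ (i - n)) a *: hw i.
Proof.
move=> nb; elim/(@fock_ind R dataA2): a => [|c m g v IH].
  rewrite /zmode msupp0 big_seq_fset0 big1 // => i _.
  by rewrite linear0 scale0r.
rewrite zmode_linl IH [zmode _ _](_ : _ = Ybasis m g ((wt (m, g))%:Z - 1) (hw n)); last first.
  exact: (@malg_liftU _ _ L (fun k : hmon * A2 => Ybasis k.1 k.2 ((wt k)%:Z - 1) (hw n)) (m, g)).
rewrite (Ybasis_hw m g nb) scaler_sumr -big_split.
apply: eq_bigr => i _; rewrite [RHS]/=.
by rewrite phi_is_scalar phi_vec scalerDl scalerA.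
Qed.

Lemma Ubot_hw n : n \in bottom_labels -> @Ubot R e lam (hw n).
Proof.
move=> nb; exists 1%N, (fun=> 1), (fun=> hw n); split; last by rewrite big_ord1 scale1r.
move=> _; move: nb; rewrite /bottom_labels; case: e => /=; rewrite !inE.
  by case/orP => /eqP ->; [left|right].
by move/eqP ->.
Qed.

Lemma Ubot_ind (S : set L) : subspace S -> (forall n, n \in bottom_labels -> S (hw n)) ->
  forall w, @Ubot R e lam w -> S w.
Proof.
move=> subS Sh; apply: subspace_lspan => // w; move: Sh; rewrite /bottom_labels; case: e => /= Sh.
  by case=> ->; apply: Sh; rewrite !inE eqxx ?orbT.
by move=> ->; apply: Sh; rewrite inE.
Qed.

Lemma Ubot_subspace : subspace (@Ubot R e lam).
Proof. exact: lspan_subspace. Qed.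

Lemma zmode_Ubot a w : @Ubot R e lam w -> @Ubot R e lam (zmode a w).
Proof.
have S := Ubot_subspace.
apply: (@Ubot_ind [set w | @Ubot R e lam (zmode a w)]%classic) => [|n nb] /=.
  split=> [|c u v Hu Hv]; rewrite /=.
    by rewrite (linear_fun0 (zmode_linr a)); exact: (subspace0 S).
  by rewrite (zmode_linr a c u v); exact: (S.2 c _ _ Hu Hv).
rewrite zmode_hw // big_seq; apply: (subspace_sum S) => i ib.
exact/(subspaceZ S)/Ubot_hw.
Qed.

End Bottom.

(** * Omega is the bottom degree *)

Section OmegaBottom.
Context {R : realType}.
Local Notation C := R[i].
Local Notation h := 'rV[C]_2.
Notation gen := ('I_2 * nat)%type.
Notation hmon := {cmonom gen}.
Local Notation VA2 := (fock (dataA2 (R:=R))).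

Section Gen.
Variable D : latdata (R:=R).
Implicit Types (w : fock D) (i : lab D).

Lemma heis_0l n w : heis (emb 0) n w = 0.
Proof.
apply: (@linear_fock_eq R D _ (heis (emb 0) n) \0) => m i /=.
case: n => [[|k]|k].
- by rewrite heis0_vec /pair_form !mxE /= !mul0r mul0rn subr0 addr0 subr0 scale0r.
- rewrite heisP_vec big1 // => s _.
  by rewrite /pair_form !mxE !mul0r mul0rn subr0 addr0 subr0 mulr0 mul0r scale0r.
by rewrite NegzE heisN_vec big1 // => s _; rewrite !mxE scale0r.
Qed.

Lemma ser_exp_0 (A : opser D) p w : (forall n w, A n w = 0) ->
  ser_exp A p w = if p is 0 then w else 0.
Proof.
move=> A0; rewrite /ser_exp big_ord_recl /= big1 ?addr0 => [|j _]; last first.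
  by rewrite /= /ser_mul big1 ?scaler0.
by rewrite fact0 invr1 scale1r; case: p.
Qed.

Lemma Eminus_0 p w : Eminus 0 p w = if p is 0 then w else 0.
Proof.
by apply: ser_exp_0 => -[//|n] {}w; rewrite heis_0l scaler0.
Qed.

Lemma Eplus_0 p w : Eplus 0 p w = if p is 0 then w else 0.
Proof.
by apply: ser_exp_0 => -[//|n] {}w; rewrite heis_0l scaler0.
Qed.

Lemma Yexp_0 n w : (forall i, ecoef 0 i = 1) -> (forall i, shift 0 i = i) ->
  (forall i, zpow 0 i = 0) -> @Yexp R D 0 n w = (n == -1)%:R *: w.
Proof.
move=> e1 s0 z0; elim/(@fock_ind R D): w => [|c m i w IH]; first by rewrite scaler0 linear0.
rewrite Yexp_is_linear scalerDr scalerA (mulrC _ c) -scalerA.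
suff Ev : Yexp 0 n (vec m i) = (n == -1)%:R *: vec m i by rewrite Ev IH.
rewrite /Yexp lext_vec e1 s0 z0 scale1r (@fsbig_nat_trunc _ _ 1) => [|[//|q] _]; last first.
  by rewrite Eplus_0; case: (_ - 1) => // p; rewrite linear0.
rewrite big_ord1 Eplus_0 /=; case E : (_ - 1) => [[|p]|p].
- by rewrite Eminus_0 (_ : n == -1 = true) ?scale1r //; apply/eqP; lia.
- by rewrite Eminus_0 (_ : n == -1 = false) ?scale0r //; apply/eqP; lia.
- by rewrite (_ : n == -1 = false) ?scale0r //; apply/eqP; lia.
Qed.

Lemma coef_heisP u k w m i : (heis u k.+1%:Z w)@_(m, i) =
  \sum_(s < 2) k.+1%:R * pair_form u (simple s) *
     ((m (s, k)).+1%:R * w@_(mulcm m (ucm (s, k)), i)).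
Proof.
elim/(@fock_ind R D): w => [|c m' j w IH].
  by rewrite linear0 mcoeff0 big1 // => s _; rewrite mcoeff0 !mulr0.
suff Ev : (heis u k.+1%:Z (vec m' j))@_(m, i) =
  \sum_(s < 2) k.+1%:R * pair_form u (simple s) *
     ((m (s, k)).+1%:R * (vec m' j)@_(mulcm m (ucm (s, k)), i)).
  rewrite heis_is_linear mcoeffD mcoeffZ.
  apply: etrans (congr2 (fun x y => c * x + y) Ev IH) _.
  rewrite mulr_sumr -big_split.
  by apply: eq_bigr => s _; rewrite mcoeffD mcoeffZ /=; ring.
rewrite heisP_vec raddf_sum; apply: eq_bigr => s _ /=.
rewrite mcoeffZ !vecE !xpair_eqE -[LHS]mulrA.
apply: (congr1 ( *%R (k.+1%:R * pair_form u (simple s)))).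
have [ms|ms] := eqVneq (m' (s, k)) 0%N.
  rewrite ms mul0r; case: eqP => [E|_]; last by rewrite mulr0.
  by move: ms; rewrite E mulcmE ucmE eqxx addn1.
have -> : (divcm m' (ucm (s, k)) == m) = (m' == mulcm m (ucm (s, k))).
  by apply/eqP/eqP => [<-|->]; rewrite ?divcmK ?mulcmK.
case: eqP => [->|_]; last by rewrite !mulr0.
by rewrite mulcmE ucmE eqxx addn1.
Qed.

(** The Gram matrix of alpha and beta is invertible, so the conditions on all positive
    modes separate the partial derivatives in the generators; a nonconstant monomial
    has a nonzero one. *)
Lemma singular_vec w : (forall (s : 'I_2) k, heis (simple s) k.+1%:Z w = 0) ->
  forall m i, w@_(m, i) != 0 -> m = onecm gen.
Proof.
move=> Hw m i wm; apply: gens_nil.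
case E : (gens m) => [//|[s k] l]; case/eqP: wm.
have ms : m (s, k) != 0%N by rewrite -count_gens E /= eqxx.
rewrite -(divcmK ms); move: (divcm _ _) => m'.
pose a (t : 'I_2) : C := (m' (t, k)).+1%:R * w@_(mulcm m' (ucm (t, k)), i).
have k1 : k.+1%:R != 0 :> C by rewrite pnatr_eq0.
have eqa t : pair_form (simple t) (simple 0) * a 0 + pair_form (simple t) (simple 1) * a 1 = 0.
  have := congr1 (mcoeff (m', i)) (Hw t k).
  rewrite coef_heisP mcoeff0 sum_rV2 -/(a 0) -/(a 1) => E'.
  apply: (mulfI k1); rewrite mulr0 -[RHS]E'.
  by move: (a 0) (a 1) => a0 a1; ring.
suff : a s = 0.
  by move/eqP; rewrite mulf_eq0 pnatr_eq0 /= => /eqP.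
have n3 : (3%:R : C) != 0 by rewrite pnatr_eq0.
have := eqa 0; have := eqa 1; rewrite !pair_form_simple !mxE !eqxx /= => E1 E0.
clear -E0 E1 n3; have [->|->] : s = 0 \/ s = 1.
  by case: (s) => -[|[|//]] j; [left|right]; apply: val_inj.
- move: (a 0) (a 1) E1 E0 => x y E1 E0; apply: (mulfI n3); rewrite mulr0.
  transitivity (2%:R * ((1 *+ 3 - (1 + 0)) * x + (0 *+ 3 - (0 + 1)) * y) +
    ((0 *+ 3 - (1 + 0)) * x + (1 *+ 3 - (0 + 1)) * y)); first by ring.
  by rewrite E0 E1 mulr0 addr0.
- move: (a 0) (a 1) E1 E0 => x y E1 E0; apply: (mulfI n3); rewrite mulr0.
  transitivity (((1 *+ 3 - (1 + 0)) * x + (0 *+ 3 - (0 + 1)) * y) +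
    2%:R * ((0 *+ 3 - (1 + 0)) * x + (1 *+ 3 - (0 + 1)) * y)); first by ring.
  by rewrite E0 E1 mulr0 addr0.
Qed.

End Gen.
Variables (e : bool) (lam : h).
Local Notation D := (dataL e lam).
Local Notation L := (fock D).
Local Notation hw := (@vec R D (onecm gen)).
Local Notation Omega := (@Omega R e lam).

Lemma mode_linr a n : linear (mode a n : L -> L).
Proof.
move=> c u v; rewrite /mode scaler_sumr -big_split; apply: eq_bigr => k _ /=.
by rewrite /Ybasis Ynop_is_linear scalerDr !scalerA mulrC.
Qed.

Lemma mode_vec m (g : A2) n (w : L) : mode (@vec R dataA2 m g) n w = Ybasis m g n w.
Proof. exact: (@malg_liftU _ _ L (fun k : hmon * A2 => Ybasis k.1 k.2 n w) (m, g)). Qed.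

Lemma homog_vec m (g : A2) : homog (wt (m, g)) (@vec R dataA2 m g).
Proof. by move=> k; rewrite -mcoeff_neq0 vecE; case: ((m, g) =P k) => [<-//|_]; rewrite eqxx. Qed.

Lemma VP_vec m (g : A2) : 0 <= g 0 1 -> VP (@vec R dataA2 m g).
Proof.
move=> g1 m' g'; rewrite (@vecE R dataA2); case: ((m, g) =P (m', g')) => [[_ <-]//|_].
by rewrite eqxx.
Qed.

Lemma Ybasis_hw_lt m (g : A2) (n i : int) : i \in bottom_labels e ->
  (wt (m, g))%:Z - n - 1 < 0 -> Ybasis m g n (hw i) = 0.
Proof.
rewrite bottom_labelsE => /eqP i0 neg.
have [g1|g1] := eqVneq (g 0 1) 0; last first.
  by apply: Ynop_ecoef0 => j; rewrite ecoefL (negbTE g1).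
have Z := @excess_shift R e lam g i g1; rewrite i0 subr0 in Z.
apply: bihom_lt0 (@bihom_Ynop R D (gens m) g n _ _ _ (@bihom_hw R D i)).
have := excess_ge0 e (g 0 0 + i); rewrite -Z; move: neg; rewrite wt_seqwt /= -/(halfnorm g); lia.
Qed.

Lemma Omega_subspace : subspace Omega.
Proof.
split=> [|c u v Hu Hv] d a n Va Ha neg; first exact: (linear_fun0 (mode_linr a n)).
by rewrite mode_linr (Hu d) // (Hv d) // scaler0 addr0.
Qed.

Lemma Ubot_Omega w : @Ubot R e lam w -> Omega w.
Proof.
apply: Ubot_ind; first exact: Omega_subspace.
move=> i ib d a n Va Ha neg; rewrite /mode big_seq big1 // => k ka.
by rewrite Ybasis_hw_lt ?scaler0 // -surjective_pairing (Ha k ka).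
Qed.

Lemma Ybasis_heis (s : 'I_2) (k : nat) (w : L) :
  Ybasis (ucm (s, 0%N)) 0 k.+1%:Z w = heis (simple s) k.+1%:Z w.
Proof.
have -> : Ybasis (ucm (s, 0%N)) 0 k.+1%:Z w = Ynop [:: (s, 0%N)] 0 k.+1%:Z w.
  rewrite /Ybasis; congr (Ynop _ _ _ _); apply: perm_small_eq => //.
  by have := gensM (onecm gen) (s, 0%N); rewrite gens1 mul0cm.
have Y0 n (v : L) : Yexp 0 n v = (n == -1)%:R *: v.
  apply: Yexp_0 => i /=; first by rewrite mxE eqxx /eps mxE mul0r expr0z.
    by rewrite mxE add0r.
  by rewrite /pair_form !mxE /= !mul0r !mul0rn subr0 addr0.
rewrite /= -[RHS]add0r; congr (_ + _).
  apply: fsbig1 => j _; rewrite Y0 (_ : _ == -1 = false) ?scale0r ?linear0 ?scaler0 //.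
rewrite (@fsbig_nat_trunc _ _ k.+2) => [|j kj]; last first.
  rewrite Y0 (_ : _ == -1 = false) ?scale0r ?scaler0 //; apply/eqP; lia.
rewrite big_ord_recr big1 => [|j _]; last first.
  rewrite Y0 (_ : _ == -1 = false) ?scale0r ?scaler0 //.
  by apply/eqP; move: (ltn_ord j) => /=; lia.
rewrite /= Y0 (_ : _ == -1 = true) ?scale1r ?bin0 ?mulr1 ?add0r ?expr0 ?scale1r //.
by apply/eqP; lia.
Qed.

Lemma Omega_singular w : Omega w -> forall m i, w@_(m, i) != 0 -> m = onecm gen.
Proof.
move=> Ow; apply: singular_vec => s k; rewrite -Ybasis_heis -mode_vec.
have ho := @homog_vec (ucm (s, 0%N)) (0 : A2).
apply: (Ow _ _ _ _ ho); first by apply: VP_vec; rewrite mxE.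
rewrite wt_seqwt /= (_ : seqwt _ = 1%N); last first.
  by have := seqwt_gensM (onecm gen) (s, 0%N); rewrite mul0cm gens1 /seqwt big_nil.
have -> : pair_form (0 : A2) 0 = 0 by rewrite /pair_form !mxE; ring.
by lia.
Qed.

(** A mode of e^(-i alpha) maps e^i to e^0 and every other e^j to a different label.
    It lowers the weight exactly if e^i is not in the bottom. *)
Lemma coef_Omega w (i : int) : Omega w -> w@_(onecm gen, i) != 0 -> i \in bottom_labels e.
Proof.
move=> Ow wi; have sing := Omega_singular Ow; rewrite bottom_labelsE; apply/negPn/negP => hi.
pose g : A2 := alpha *~ (- i).
have g0 : g 0 0 = - i by rewrite alphaE eqxx.
have g1 : g 0 1 = 0 by rewrite alphaE.
pose n : int := - @zpow R D g i - 1.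
have E : mode (@vec R dataA2 (onecm gen) g) n w = 0.
  apply: (Ow _ _ _ _ (@homog_vec _ _)); first by apply: VP_vec; rewrite g1.
  have h0 : excess e 0 = 0 by rewrite /excess mul0r mul0rn.
  have := @excess_shift R e lam g i g1; have := excess_ge0 e i; move: hi.
  by rewrite wt_seqwt gens1 /seqwt big_nil g0 addNr h0 /n /= -/(halfnorm g); lia.
case/eqP: wi; have := congr1 (mcoeff (onecm gen, 0 : int)) E.
rewrite mode_vec /Ybasis gens1 mcoeff0 /= => E0.
suff <- : (Yexp g n w)@_(onecm gen, 0 : int) = w@_(onecm gen, i) by [].
have Ew : w = \sum_(k <- msupp w) w@_k *: hw k.2.
  rewrite {1}(monalgE w); apply: eq_big_seq => -[m j] kw.
  have mE : m = onecm gen by apply: (sing m j); rewrite mcoeff_neq0.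
  by rewrite malgUZ mE.
have -> : Yexp g n w = \sum_(k <- msupp w) w@_k *: Yexp g n (hw k.2).
  by rewrite {1}Ew linear_sum; apply: eq_bigr => k _; rewrite linearZ.
rewrite [in RHS]Ew !raddf_sum; apply: eq_bigr => k _; rewrite /= !mcoeffZ.
apply: (congr1 ( *%R w@_k)).
rewrite (@coef_Yexp_hw R D) (@vecE R D) ecoefL g1 eqxx /= g0 xpair_eqE eqxx /=.
rewrite (_ : (- i + k.2 == 0) = (k.2 == i)); last by apply/eqP/eqP; lia.
case: eqP => [->|//]; rewrite (_ : _ + _ == 0 = true) //.
by apply/eqP; rewrite /n /=; lia.
Qed.

Lemma Omega_Ubot w : Omega w -> @Ubot R e lam w.
Proof.
move=> Ow; have sing := Omega_singular Ow.
rewrite [w]monalgE big_seq; apply: (subspace_sum (Ubot_subspace e lam)) => -[m i] kw.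
have wk : w@_(m, i) != 0 by rewrite mcoeff_neq0.
have mE := sing m i wk; rewrite malgUZ; rewrite {m kw}mE in wk *.
by apply: (subspaceZ (Ubot_subspace e lam)); apply: Ubot_hw; exact: coef_Omega wk.
Qed.

End OmegaBottom.

(** * Zhu's relations on the bottom *)

Section Action.
Context {R : realType}.
Local Notation C := R[i].
Local Notation h := 'rV[C]_2.
Notation gen := ('I_2 * nat)%type.
Notation hmon := {cmonom gen}.
Local Notation VA2 := (fock (dataA2 (R:=R))).

Variables (e : bool) (lam : h).
Hypothesis hlam : pair_form lam alpha = 0.
Local Notation D := (dataL e lam).
Local Notation L := (fock D).
Local Notation hw := (@vec R D (onecm gen)).
Local Notation Ubot := (@Ubot R e lam).
Local Notation rho := (rootpair e lam).
Local Notation low := (bottom_labels e).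
Implicit Types (a b : VA2) (w : L).

Lemma embD (g g' : A2) : emb (g + g') = emb g + emb g' :> h.
Proof. by apply/rowP => s; rewrite !mxE rmorphD. Qed.

Lemma shiftv_rootpair n k : shiftv (rho n) (alpha *~ k) = rho (n + k).
Proof.
apply/funext => s; rewrite /shiftv /rootpair -pair_formDr /=.
congr (pair_form _ _); rewrite mulrzDr embD -!addrA; congr (_ + _).
by rewrite addrA addrC.
Qed.

Lemma dotv_rootpair g n : dotv (rho n) (emb g) = pair_form (emb g) (@mu R D n).
Proof. exact: dotv_form. Qed.

(** Here lam being orthogonal to alpha makes (g|mu) an integer for g in Z alpha. *)
Lemma dotv_rootpair_alpha k n :
  dotv (rho n) (emb (alpha *~ k)) = (@zpow R D (alpha *~ k) n)%:~R.
Proof.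
rewrite dotv_rootpair [mu _]/= [zpow _ _]/= !pair_formDr emb_form.
rewrite [RHS](mulrzDr _ (pair_form _ _)) -addrA; congr (_ + _).
have -> : emb (alpha *~ k) = k%:~R *: (alpha : h).
  apply/rowP => s; rewrite !mxE alphaE /=.
  by case: (s == 0); rewrite ?mulr1 ?mulr0 ?mulr1n ?mulr0n.
have Z (c : C) (x y : h) : pair_form (c *: x) y = c * pair_form x y.
  by rewrite /pair_form !mxE; ring.
rewrite !Z (pair_formC _ lam) hlam mulr0 addr0 alphaE eqxx mulr1n.
rewrite /epsv; case: e => /=; last by rewrite mulr0n /pair_form !mxE; ring.
have n2 : (2%:R : C) != 0 by rewrite pnatr_eq0.
rewrite mulr1n (_ : pair_form _ _ = 1) ?mulr1 //.
by rewrite pair_formC Z /pair_form !mxE !eqxx /=; field.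
Qed.

Lemma phi_star_alpha m k n i b : n \in low -> i \in low ->
  phi (rho n) (alpha *~ (i - n)) (zbasis 1 (m, alpha *~ k) b) =
  (i - k \in low)%:R * (chi (rho (i - k)) m * phi (rho n) (alpha *~ (i - k - n)) b).
Proof.
rewrite !bottom_labelsE => /eqP n0 /eqP i0.
have k0 : (alpha *~ k : A2) 0 0 = k by rewrite alphaE eqxx.
have k1 : (alpha *~ k : A2) 0 1 = 0 by rewrite alphaE.
have Z := @excess_shift R e lam (alpha *~ k) n k1; rewrite n0 subr0 k0 in Z.
have EN : dotv (rho n) (emb (alpha *~ k)) + (halfnorm (alpha *~ k))%:R
    = (absz (excess e (k + n)))%:R.
  rewrite dotv_rootpair_alpha natr_absz ger0_norm ?excess_ge0 // -Z [RHS](mulrzDr _ (Posz _)) [LHS]addrC.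
  by rewrite -pmulrn.
rewrite (_ : alpha *~ (i - n) = alpha *~ k + alpha *~ (i - k - n)); last first.
  by rewrite -mulrzDr; congr (_ *~ _); ring.
have M : pair_form (alpha *~ k) (alpha *~ (i - k - n)) + (absz (excess e (k + n)))%:Z
    = - excess e (i - k).
  rewrite gez0_abs ?excess_ge0 //; apply/eqP; rewrite -addr_eq0; apply/eqP.
  transitivity (excess e n + excess e i); last by rewrite n0 i0.
  rewrite /pair_form !alphaE /= /excess; case: e; rewrite ?mulr1n ?mulr0n; ring.
rewrite (phi_star m b EN) ?M ?oppr_le0 ?excess_ge0 // oppr_eq0; congr (_ * _).
rewrite shiftv_rootpair (_ : n + (i - k - n) = i - k); last by ring.
by rewrite /eps k1 mul0r expr0z mul1r.
Qed.

Lemma phi_zbasis_VP (v : 'I_2 -> C) r m (g g0 : A2) b : VP b -> 0 < g 0 1 -> g0 0 1 = 0 ->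
  phi v g0 (zbasis r (m, g) b) = 0.
Proof.
move=> Vb g1 g01; rewrite /zbasis linear_sum big1 // => j _.
rewrite linearZ /= [X in _ * phi _ _ X](_ : _ = \sum_(k <- msupp b)
  b@_k *: Ybasis m g (j%:Z - r%:Z) (@vec R dataA2 k.1 k.2)); last first.
  rewrite /Ybasis {1}(monalgE b) linear_sum; apply: eq_bigr => -[m' g'] _.
  by rewrite malgUZ linearZ.
rewrite linear_sum big_seq big1 ?mulr0 // => -[m' g'] kb; rewrite linearZ /=.
rewrite (phi_bihom _ _ (@bihom_Ynop R dataA2 _ g _ _ _ _ (@bihom_vec R dataA2 m' g'))).
  by rewrite mulr0.
have := Vb m' g'; rewrite mcoeff_neq0 => /(_ kb) g'1.
apply/eqP => E; have := congr1 (fun x : A2 => x 0 1) E.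
rewrite /= mxE g01; move: g1 g'1; move: (g 0 1) (fun_of_matrix g' _ _) => x y; lia.
Qed.

(** If g has a positive beta component then both sides vanish, b having no negative
    one.  For g in Z alpha the two sides are compared on each bottom label i: the
    intermediate vector e^(i - k) either is in the bottom or contributes to neither. *)
Lemma zmode_zbasis m (g : A2) b n : VP b -> 0 <= g 0 1 -> n \in low ->
  zmode (zbasis 1 (m, g) b) (hw n) =
  Ybasis m g ((wt (m, g))%:Z - 1) (zmode b (hw n) : L).
Proof.
move=> Vb; rewrite le_eqVlt => /orP[/eqP g1|g1] nb; last first.
  rewrite zmode_hw // big1 => [|i _]; last first.
    by rewrite phi_zbasis_VP ?scale0r // alphaE.
  rewrite /Ybasis Ynop_ecoef0 // => i.
  by rewrite ecoefL; case: eqP g1 => // ->.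
have Eg : g = alpha *~ (g 0 0).
  by apply/eqP; rewrite alpha_eqE -g1 !eqxx.
move: (g 0 0) Eg => k -> {g g1}.
rewrite !zmode_hw // /Ybasis linear_sum.
under [RHS]eq_big_seq => j jb.
  rewrite linearZ /= -[Ynop _ _ _ _]/(Ybasis m (alpha *~ k) ((wt (m, alpha *~ k))%:Z - 1) (hw j)).
  rewrite Ybasis_hw // scaler_sumr; over.
rewrite exchange_big /=; apply: eq_big_seq => i ib.
under [RHS]eq_bigr => j _ do rewrite scalerA.
rewrite phi_star_alpha // -scaler_suml.
have E j : (alpha *~ k == alpha *~ (i - j) :> A2) = (j == i - k).
  by rewrite alpha_eqE !alphaE /= andbT mulr1n; apply/eqP/eqP; lia.
suff -> : \sum_(j <- low) phi (rho n) (alpha *~ (j - n)) b *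
    ((alpha *~ k == alpha *~ (i - j) :> A2)%:R * chi (rho j) m) =
  (i - k \in low)%:R * (chi (rho (i - k)) m * phi (rho n) (alpha *~ (i - k - n)) b) by [].
have [jl|jl] := boolP (i - k \in low).
  rewrite (bigD1_seq _ jl (bottom_labels_uniq e)) /= E eqxx big1 => [|j /negbTE jk].
    by rewrite addr0 !mul1r mulrC.
  by rewrite E jk mul0r mulr0.
rewrite mul0r big_seq big1 // => j jl'; rewrite E; case: eqP => [jk|_].
  by move: jl; rewrite -jk jl'.
by rewrite mul0r mulr0.
Qed.

Lemma zmode_zstar a b w : VP a -> VP b -> Ubot w ->
  zmode (zhu_star a b) w = zmode a (zmode b w : L) :> L.
Proof.
move=> Va Vb; move: w; apply: (@Ubot_ind R e lam [set w | zmode (zhu_star a b) w =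
  zmode a (zmode b w : L) :> L]%classic).
  split=> [|c u v /= Eu Ev] /=; first by rewrite !(linear_fun0 (zmode_linr _)).
  by rewrite !zmode_linr Eu Ev.
move=> n nb /=; rewrite /zhu_star zresE /malg_lift.
have lz : linear (fun x : VA2 => zmode x (hw n) : L) by exact: zmode_linl.
(* Packing a |-> a_(wt a - 1) e^n as a linear map lets it pass through the sum over
   the basis vectors of a. *)
pose f : {linear VA2 -> L} := HB.pack (fun x : VA2 => zmode x (hw n) : L)
  (GRing.isLinear.Build C VA2 L *:%R _ lz).
rewrite -[LHS]/(f _) linear_sum; apply: eq_big_seq => -[m g] ka.
rewrite linearZ /= zmode_zbasis //.
by have := Va m g; rewrite mcoeff_neq0; apply.
Qed.

Hypothesis Hmin : forall n, n \in low -> minvec (rho n).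

Lemma zmode_zcirc a b w : Ubot w -> zmode (zhu_circ a b) w = 0 :> L.
Proof.
move: w; apply: (@Ubot_ind R e lam [set w | zmode (zhu_circ a b) w = 0 :> L]%classic).
  split=> [|c u v /= Eu Ev] /=; first by rewrite (linear_fun0 (zmode_linr _)).
  by rewrite zmode_linr Eu Ev scaler0 addr0.
move=> n nb /=; rewrite zmode_hw // big_seq big1 // => i ib.
rewrite phi_circ ?scale0r //; first exact: Hmin.
by rewrite shiftv_rootpair (_ : n + (i - n) = i); [apply: Hmin | ring].
Qed.

Lemma zmode_Ogen a w : lspan (Ogen [set: VA2]%classic) a -> Ubot w ->
  zmode a w = 0 :> L.
Proof.
move=> Oa Uw; move: a Oa; apply: (@subspace_lspan _ _ [set a | zmode a w = 0 :> L]%classic).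
  split=> [|c u v /= Eu Ev] /=; last by rewrite zmode_linl Eu Ev scaler0 addr0.
  by rewrite /zmode msupp0 big_seq_fset0.
by move=> _ [d [a [b [_ _ _ ->]]]]; apply: zmode_zcirc.
Qed.

Lemma zmode_cls a a' w : cls (Ogen [set: VA2]%classic) a = cls _ a' -> Ubot w ->
  zmode a w = zmode a' w :> L.
Proof.
move=> /clsP Oa Uw; apply/eqP; rewrite -subr_eq0 -[a](subrK a').
rewrite -[a - a']scale1r zmode_linl scale1r zmode_Ogen // add0r.
by rewrite subrr.
Qed.

Lemma zmode_vac w : Ubot w -> zmode vac w = w :> L.
Proof.
move: w; apply: (@Ubot_ind R e lam [set w | zmode vac w = w :> L]%classic).
  split=> [|c u v /= Eu Ev] /=; first by rewrite (linear_fun0 (zmode_linr _)).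
  by rewrite zmode_linr Eu Ev.
move=> n nb /=; rewrite zmode_hw // (bigD1_seq _ nb (bottom_labels_uniq e)) /= big1 => [|i ni].
  by rewrite /vac phi_vec subrr mulr0z eqxx /chi gens1 big_nil mulr1 scale1r addr0.
rewrite /vac phi_vec alpha_eqE mxE eq_sym subr_eq0 (negbTE ni).
by rewrite mul0r scale0r.
Qed.

End Action.

(** * The quotient at minimal weights *)

Section QuotientClasses.
Context {K : fieldType} {W : lmodType K}.

Lemma clsZ (A : set W) c w : cls A (c *: w) = c *: cls A w.
Proof. by rewrite [RHS]quo_scaleE. Qed.

Lemma cls_linear (A : set W) c u v : cls A (c *: u + v) = c *: cls A u + cls A v.
Proof. by rewrite clsD clsZ. Qed.

Lemma cls0 (A : set W) : cls A 0 = 0.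
Proof. by rewrite -(scale0r (0 : W)) clsZ scale0r. Qed.

(** Dividing by nothing but 0 makes the chosen representative canonical. *)
Lemma cls_repr0 (A : set W) w : (forall u, A u -> u = 0) -> quo_repr (cls A w) = w.
Proof.
move=> A0; have S : subspace [set u : W | u = 0]%classic.
  by split=> // c u v /= -> ->; rewrite scaler0 addr0.
apply/eqP; rewrite -subr_eq0; apply/eqP.
apply: (subspace_lspan S A0); apply/clsP; exact: cls_repr.
Qed.
End QuotientClasses.

Section PositivePart.
Context {R : realType}.
Local Notation C := R[i].
Local Notation h := 'rV[C]_2.
Local Notation VA2 := (fock (dataA2 (R:=R))).
Variables (e : bool) (lam : h).
Hypothesis hlam : pair_form lam alpha = 0.
Hypothesis Hmin : forall n, n \in bottom_labels e -> minvec (rootpair e lam n).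
Local Notation D := (dataL e lam).
Local Notation L := (fock D).
Local Notation Omega := (@Omega R e lam).
Local Notation Ubot := (@Ubot R e lam).
Local Notation OA := (@Ogen R [set: VA2]%classic).
Local Notation kerOm := (@kerOmega R e lam).

(** Elements of ker(pi) are classes of elements of O(V_{A_2}), which act by zero. *)
Lemma kerOmega0 w : kerOm w -> w = 0.
Proof.
move=> [a [u [Va [_ Ka] Ou ->]]]; apply: (zmode_Ogen Hmin); last exact: Omega_Ubot.
by rewrite -[a]subr0; apply/clsP; rewrite -zpi_cls Ka cls0.
Qed.

Lemma clsK w : quo_repr (cls kerOm w) = w.
Proof. exact: cls_repr0 kerOmega0. Qed.

(** Independent of the representative on the bottom, since O(V_{A_2}) acts by zero. *)
Definition act (x : quo OA) (u : L) : L := zmode (quo_repr x) u.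

Lemma act_cls a u : Ubot u -> act (cls OA a) u = zmode a u.
Proof. by apply: (zmode_cls Hmin); exact: cls_repr. Qed.

Lemma act_lin x y c u : Ubot u -> act (c *: x + y) u = c *: act x u + act y u.
Proof.
move=> Uu; rewrite -{1}(cls_repr x) -{1}(cls_repr y) -cls_linear act_cls //.
exact: zmode_linl.
Qed.

Lemma act_star a b u : VP a -> VP b -> Ubot u ->
  act (cls OA (zhu_star a b)) u = act (cls OA a) (act (cls OA b) u).
Proof.
move=> Va Vb Uu; rewrite !act_cls ?zmode_zstar //.
by apply: zmode_Ubot.
Qed.

Definition actQ (x : quo OA) (q : quo kerOm) : quo kerOm :=
  cls kerOm (act x (quo_repr q)).

Lemma actQ_cls x u : actQ x (cls kerOm u) = cls kerOm (act x u).
Proof. by rewrite /actQ clsK. Qed.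

Lemma OmegaQ_eq_U_of_min : OmegaQ_eq_U e lam.
Proof.
have S := Ubot_subspace e lam.
exists act, actQ; split.
- split; last by move=> a u Va Uu; rewrite zpi_cls act_cls.
  split.
  + exact: S.
  + by move=> x u _; apply: zmode_Ubot.
  + split=> [c x u v _ _ _|c x y u _ _ Uu]; first exact: zmode_linr.
    exact: act_lin.
  + by move=> u Uu; rewrite act_cls // zmode_vac.
  + exact: act_star.
- split; last first.
    by move=> a w Va Ow; rewrite zpi_cls actQ_cls act_cls //; apply: Omega_Ubot.
  split.
  + split.
      by exists 0; [exact: (subspace0 (Omega_subspace e lam)) | exact: cls0].
    move=> c _ _ [u Ou <-] [v Ov <-]; exists (c *: u + v); last exact: cls_linear.
    exact: ((Omega_subspace e lam).2).
  + move=> x _ _ [u Ou <-]; rewrite actQ_cls; exists (act x u); last exact: erefl.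
    by apply: Ubot_Omega; apply: zmode_Ubot; apply: Omega_Ubot.
  + split=> [c x _ _ _ [u Ou <-] [v Ov <-]|c x y _ _ _ [u Ou <-]].
      apply: etrans (congr1 (actQ x) (esym (cls_linear kerOm c u v))) _.
      apply: etrans (actQ_cls x (c *: u + v)) _.
      apply: etrans (congr1 (cls kerOm) (zmode_linr _ c u v)) _.
      apply: etrans (cls_linear _ c _ _) _.
      exact: (congr2 (fun p q => c *: p + q) (esym (actQ_cls x u)) (esym (actQ_cls x v))).
    apply: etrans (actQ_cls _ _) _.
    apply: etrans (congr1 (cls kerOm) (act_lin x y c (Omega_Ubot Ou))) _.
    apply: etrans (cls_linear _ c _ _) _.
    exact: (congr2 (fun p q => c *: p + q) (esym (actQ_cls x u)) (esym (actQ_cls y u))).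
  + move=> _ [u Ou <-]; have Uu := Omega_Ubot Ou.
    by rewrite actQ_cls act_cls // zmode_vac.
  + move=> a b _ Va Vb [u Ou <-]; have Uu := Omega_Ubot Ou.
    apply: etrans (actQ_cls _ _) _; apply: etrans (congr1 (cls kerOm) (act_star Va Vb Uu)) _.
    apply: etrans (esym (actQ_cls _ _)) _.
    exact: (congr1 (actQ (cls OA a)) (esym (actQ_cls _ _))).
- split.
  + by move=> u Uu; exists u; [apply: Ubot_Omega|exact: erefl].
  + by move=> u v _ _ E; rewrite -[u]clsK E clsK.
  + by move=> _ [u Ou <-]; exists u; [apply: Omega_Ubot|exact: erefl].
- by move=> x u _ _; rewrite actQ_cls.
Qed.

End PositivePart.

Section Minimal.
Context {R : realType}.
Local Notation C := R[i].

Lemma minvec_int (v : 'I_2 -> C) (p q : int) : v 0 = p%:~R -> v 1 = q%:~R ->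
  (forall x y : int, 0 <= x * x + y * y - x * y + p * x + q * y) -> minvec v.
Proof.
move=> v0 v1 pos g; have := pos (g 0 0) (g 0 1).
set N := (X in 0 <= X) => N0; exists (absz N).
rewrite /dotv sum_rV2 v0 v1 natr_absz ger0_norm // !mxE.
have hE : (halfnorm g)%:Z = g 0 0 * g 0 0 + g 0 1 * g 0 1 - g 0 0 * g 0 1.
  have := halfnormE g; rewrite /pair_form; move: (g 0 0) (g 0 1) (halfnorm g) => x y H; lia.
by rewrite pmulrn hE /N !(rmorphD, rmorphN, rmorphM) /=; ring.
Qed.

(** The pairings of 0 and of the six minimal vectors of the dual lattice with alpha and
    beta.  Twice the quadratic expression is a sum of three terms of the form
    t (t + 1), t (t - 1) or t^2, with t among x, y and x - y up to sign. *)
Lemma min_weights (p q : int) :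
  (p, q) \in [:: (0, 0); (0, 1); (0, -1); (1, 0); (-1, 0); (1, -1); (-1, 1)] ->
  forall x y : int, 0 <= x * x + y * y - x * y + p * x + q * y.
Proof.
have T (t : int) : 0 <= t * (t + 1) by nia.
have T' (t : int) : 0 <= t * (t - 1) by nia.
have S (t : int) : 0 <= t * t by nia.
move=> pq x y; have := T x; have := T y; have := T (x - y).
have := T' x; have := T' y; have := T' (x - y); have := S x; have := S y; have := S (x - y).
by move: pq; rewrite !inE => /orP[/eqP[-> ->]|]; last (do 5?[case/orP => [/eqP[-> ->]|]]);
  last (move/eqP => [-> ->]); nia.
Qed.

End Minimal.

(** * Elements of ker(pi) with nonzero action *)

Section NegativePart.
Context {R : realType}.
Local Notation C := R[i].
Local Notation h := 'rV[C]_2.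
Notation gen := ('I_2 * nat)%type.
Local Notation VA2 := (fock (dataA2 (R:=R))).
Local Notation ev g := (@vec R dataA2 (onecm gen) g).

Lemma Yexp_opp (v : 'I_2 -> C) (g : A2) (n : int) (p : nat) :
  pair_form g g - n - 1 = p%:Z ->
  phi v 0 (Yexp g n (ev (- g))) = eps g (- g) * gbin (dotv v (emb g)) p.
Proof.
move=> E; rewrite (@Yexp_hw R dataA2) /= pair_formNr opprK E linearZ /= phi_Eminus.
by rewrite phi_vec subrr eqxx /chi gens1 big_nil !mulr1.
Qed.

(** Since (g|-g) = -2 and wt e^g = 1, this is Res_z of z^-4 (1 + z)^(x + 1), where
    x = (g|mu). *)
Lemma phi_circ_opp (v : 'I_2 -> C) (g : A2) : pair_form g g = 2 ->
  phi v 0 (zhu_circ (ev g) (ev (- g))) =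
  eps g (- g) * gbin (dotv v (emb g) + 1) 3.
Proof.
move=> g2; have h1 : halfnorm g = 1%N by rewrite /halfnorm g2.
rewrite /zhu_circ zres_vec.
rewrite -{1}(subrr g) phi_zbasis gens1 /seqwt big_nil h1 subrr [iter _ _ _ _]/= /mul1z.
have n3 : pair_form g g - - 2%:Z - 1 = 3%:Z by rewrite g2.
have n2 : pair_form g g - (- 2%:Z + 1) - 1 = 2%:Z by rewrite g2.
by apply: etrans (congr2 +%R (Yexp_opp v n3) (Yexp_opp v n2)) _; rewrite -mulrDr -gbinS.
Qed.

Lemma gbin3 (x : C) : gbin (x + 1) 3 = (x + 1) * x * (x - 1) / 6%:R.
Proof.
rewrite /= mulr1n !divr1 mul1r subr0.
have -> : (6%:R : C) = 2%:R * 3%:R by rewrite -natrM.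
by rewrite invfM; ring.
Qed.

Variables (e : bool) (lam : h).
Hypothesis hlam : pair_form lam alpha = 0.
Local Notation D := (dataL e lam).
Local Notation L := (fock D).
Local Notation hw := (@vec R D (onecm gen)).
Local Notation kerOm := (@kerOmega R e lam).

Lemma zmode_circ_opp (g : A2) n : pair_form g g = 2 -> n \in bottom_labels e ->
  zmode (zhu_circ (ev g) (ev (- g))) (hw n) =
  (eps g (- g) * gbin (dotv (rootpair e lam n) (emb g) + 1) 3) *: hw n.
Proof.
move=> g2 nb; rewrite zmode_hw // (bigD1_seq _ nb (bottom_labels_uniq e)) /= big1 => [|i ni].
  by rewrite subrr mulr0z phi_circ_opp // addr0.
rewrite /zhu_circ zres_vec.
rewrite /zbasis linear_sum big1 ?scale0r // => j _; rewrite linearZ /=.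
rewrite (phi_bihom _ _ (@bihom_Ynop R dataA2 _ g _ _ _ _ (@bihom_vec R dataA2 (onecm gen) (- g)))).
  by rewrite mulr0.
by rewrite /= subrr alpha_eqE !mxE eq_sym subr_eq0 (negbTE ni).
Qed.

Lemma VP_circ_opp (g : A2) : VP (zhu_circ (ev g) (ev (- g))).
Proof.
rewrite /zhu_circ zres_vec.
suff S0 : [set w : VA2 | forall k, w@_k != 0 -> k.2 = 0]%classic
    (zbasis 2 (onecm gen, g) (ev (- g))).
  by move=> m g' /S0 /= ->; rewrite mxE.
have S : subspace [set w : VA2 | forall k, w@_k != 0 -> k.2 = 0]%classic.
  split=> [k|c u v Hu Hv k] /=; first by rewrite mcoeff0 eqxx.
  rewrite mcoeffD mcoeffZ; have [v0|/Hv//] := eqVneq v@_k 0.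
  have [u0|/Hu//] := eqVneq u@_k 0.
  by rewrite v0 u0 mulr0 addr0 eqxx.
apply: (subspace_sum S) => j _; apply: (subspaceZ S) => k.
move/(@bihom_Ynop R dataA2 _ g _ _ _ _ (@bihom_vec R dataA2 (onecm gen) (- g))) => [_ ->].
exact: subrr.
Qed.

(** e^g o e^(-g) acts on e^n by a scalar, which the hypothesis makes nonzero. *)
Lemma kerOmega_hw (g : A2) n : pair_form g g = 2 -> n \in bottom_labels e ->
  (forall x, x = dotv (rootpair e lam n) (emb g) -> (x + 1) * x * (x - 1) != 0) ->
  lspan kerOm (hw n).
Proof.
move=> g2 nb xn; have := xn _ erefl; set x := dotv _ _ => x0.
pose a : VA2 := zhu_circ (ev g) (ev (- g)); pose c : C := eps g (- g) * gbin (x + 1) 3.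
have c0 : c != 0.
  rewrite /c mulf_neq0 // /eps; first by rewrite expfz_neq0 // oppr_eq0 oner_eq0.
  by rewrite gbin3 mulf_neq0 // invr_eq0 pnatr_eq0.
have Ka : kerOm (zmode a (hw n)).
  exists a, (hw n); split=> //; first exact: VP_circ_opp.
    split; first by exists a => //; exact: VP_circ_opp.
    rewrite zpi_cls -(cls0 (Ogen _)); apply/clsP; rewrite subr0.
    exists 1%N, (fun=> 1), (fun=> a); split; last by rewrite big_ord1 scale1r.
    move=> _; exists (wt (onecm gen, g)), (ev g), (ev (- g)); split=> //.
    exact: homog_vec.
  exact/Ubot_Omega/Ubot_hw.
exists 1%N, (fun=> c^-1), (fun=> zmode a (hw n)); split=> //.
by rewrite big_ord1 zmode_circ_opp // scalerA mulVf // scale1r.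
Qed.

Lemma OmegaQ_eq_0_of_hw : (forall n, n \in bottom_labels e -> lspan kerOm (hw n)) ->
  OmegaQ_eq_0 e lam.
Proof.
move=> H; apply/seteqP; split=> [q [w Ow <-]|q ->] /=.
  rewrite -(cls0 kerOm); apply/clsP; rewrite subr0; move: w {Ow}(Omega_Ubot Ow).
  exact: (Ubot_ind (lspan_subspace kerOm) H).
exists 0; last exact: cls0.
exact: (subspace0 (Omega_subspace e lam)).
Qed.

Lemma dotv_simple (v : 'I_2 -> C) : dotv v (emb beta) = v 1 /\ dotv v (emb (alpha + beta)) = v 0 + v 1.
Proof. by rewrite /dotv !sum_rV2 !mxE /=; split; ring. Qed.

Lemma rootpair0 n : rootpair e lam n 0 = (n *+ 2 + e%:Z)%:~R.
Proof.
have := @dotv_rootpair_alpha R e lam hlam 1 n; rewrite mulr1z /dotv sum_rV2 !mxE /=.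
rewrite mul1r mul0r addr0 => ->; rewrite /pair_form alphaE !mxE /=; congr (_%:~R).
rewrite alphaE /=; case: e; rewrite ?mulr1n ?mulr0n /=; lia.
Qed.

Lemma rootpair1 n : rootpair e lam n 1 = pair_form beta lam - n%:~R - e%:R / 2%:R.
Proof.
have En : pair_form beta (emb (alpha *~ n)) = - n%:~R :> C.
  by rewrite /pair_form !mxE !alphaE /= mulr1n mulr0n; ring.
have Ee : pair_form beta (epsv e) = - (e%:R / 2%:R) :> C.
  by rewrite /epsv; case: e; rewrite /pair_form !mxE ?eqxx /=; ring.
rewrite /rootpair /= !pair_formDr -[simple 1]/(beta : h) En Ee; ring.
Qed.

End NegativePart.

(** * The weights lam *)

Section Weights.
Context {R : realType}.
Local Notation C := R[i].
Variable lam : 'rV[C]_2.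
Hypothesis hlam : pair_form lam alpha = 0.
Local Notation t := (pair_form beta lam).

Lemma lam_lambda2 : lam = t *: lambda2.
Proof.
have n3 : (3%:R : C) != 0 by rewrite pnatr_eq0.
have E : lam 0 1 = lam 0 0 *+ 2.
  apply/eqP; rewrite -subr_eq0 -oppr_eq0 -hlam; apply/eqP.
  by rewrite /pair_form !mxE /=; ring.
apply/rowP => s; have [->|->] : s = 0 \/ s = 1.
  by case: s => -[|[|//]] i; [left|right]; apply: val_inj.
all: by rewrite /lambda2 /pair_form !mxE /= E; field.
Qed.

Lemma pair_beta_lambda2 (c : C) : pair_form beta (c *: lambda2) = c.
Proof.
have n3 : (3%:R : C) != 0 by rewrite pnatr_eq0.
by rewrite /lambda2 /pair_form !mxE /=; field.
Qed.

Lemma OmegaQ_eq_U_of_int (e : bool) :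
  (forall n, n \in bottom_labels e -> exists2 q : int, rootpair e lam n 1 = q%:~R &
    (n *+ 2 + e%:Z, q) \in
    [:: (0, 0); (0, 1); (0, -1); (1, 0); (-1, 0); (1, -1); (-1, 1)]) ->
  OmegaQ_eq_U e lam.
Proof.
move=> H; apply: OmegaQ_eq_U_of_min => // n /H[q h1 pq].
apply: (minvec_int (rootpair0 e hlam n) h1); exact: min_weights pq.
Qed.

Lemma OmegaQ_eq_0_of_root (e : bool) :
  (forall n, n \in bottom_labels e -> exists g : A2, pair_form g g = 2 /\
    forall x, x = dotv (rootpair e lam n) (emb g) -> (x + 1) * x * (x - 1) != 0) ->
  OmegaQ_eq_0 e lam.
Proof.
move=> H; apply: OmegaQ_eq_0_of_hw => n nb; have [g [g2 Hg]] := H n nb.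
exact: kerOmega_hw g2 nb Hg.
Qed.

End Weights.

Lemma cubic_neq0 (F : fieldType) (x : F) :
  ((x + 1) * x * (x - 1) != 0) = [&& x != 0, x != 1 & x != - 1].
Proof.
rewrite !mulf_eq0 !negb_or addr_eq0 subr_eq0.
by case: (x == 0); case: (x == 1); case: (x == -1).
Qed.

(** For epsv = alpha/2, the pairings of beta and alpha + beta with a bottom weight are
    t - 1/2 and t + 1/2 in some order; both are in {0, 1, -1} only for t = 1/2, -1/2. *)
Lemma cubic_shift (F : numFieldType) (t : F) : t != 2%:R^-1 -> t != - 2%:R^-1 ->
  (t - 2%:R^-1 + 1) * (t - 2%:R^-1) * (t - 2%:R^-1 - 1) != 0 \/
  (t + 2%:R^-1 + 1) * (t + 2%:R^-1) * (t + 2%:R^-1 - 1) != 0.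
Proof.
have n2 : (2%:R : F) != 0 by rewrite pnatr_eq0.
have Eh : t + 2%:R^-1 = t - 2%:R^-1 + 1 by field.
have Et : t = t - 2%:R^-1 + 2%:R^-1 by rewrite subrK.
rewrite -subr_eq0 {}Eh => w0; rewrite {1}Et; move: (t - 2%:R^-1) w0 => w w0 wh.
have w1 : w != -1.
  by apply: contra wh => /eqP ->; apply/eqP; field.
rewrite !cubic_neq0 w0 w1 /= andbT; have [w1'|] := eqVneq w 1; last by left.
have e0 : w + 1 != 0 by rewrite addr_eq0.
have e1 : w + 1 != 1 by rewrite -subr_eq0 addrK.
right; rewrite e0 e1 /= w1' -subr_eq0 opprK.
by rewrite (_ : 1 + 1 + 1 = 3%:R :> F) ?pnatr_eq0 //; ring.
Qed.

Theorem proposition8p2 (R : realType) (lam : 'rV[R[i]]_2)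
    (hlam : pair_form lam alpha = 0) :
  [/\ (lam = 0 \/ lam = lambda2 \/ lam = - lambda2) -> OmegaQ_eq_U false lam,
      ~ (lam = 0 \/ lam = lambda2 \/ lam = - lambda2) -> OmegaQ_eq_0 false lam,
      (lam = 2%:R^-1 *: lambda2 \/ lam = - (2%:R^-1 *: lambda2)) ->
        OmegaQ_eq_U true lam
    & ~ (lam = 2%:R^-1 *: lambda2 \/ lam = - (2%:R^-1 *: lambda2)) ->
        OmegaQ_eq_0 true lam].
Proof.
have lamE := lam_lambda2 hlam; set t := pair_form beta lam in lamE.
have n2 : (2%:R : R[i]) != 0 by rewrite pnatr_eq0.
have bb : pair_form beta beta = 2 :> int by rewrite /pair_form !mxE.
have ab : pair_form (alpha + beta) (alpha + beta) = 2 :> int by rewrite /pair_form !mxE.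
split.
- move=> Hl; apply: OmegaQ_eq_U_of_int => // n; rewrite inE => /eqP ->.
  have tE : t = 0 \/ t = 1 \/ t = -1.
    rewrite /t; case: Hl => [->|[->|->]].
    + by left; rewrite /pair_form !mxE; ring.
    + by right; left; rewrite -[lambda2]scale1r pair_beta_lambda2.
    + by right; right; rewrite -scaleN1r pair_beta_lambda2.
  case: tE => [tE|[tE|tE]]; [exists 0|exists 1|exists (-1)] => //;
  by rewrite rootpair1 // -/t tE mul0r !subr0.
- move=> Hl; apply: OmegaQ_eq_0_of_root => // n; rewrite inE => /eqP ->.
  exists beta; split=> // x ->; rewrite (dotv_simple _).1 rootpair1 // mul0r !subr0 -/t cubic_neq0.
  apply/and3P; split; apply/eqP => tE; apply: Hl; rewrite lamE tE.
  + by left; rewrite scale0r.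
  + by right; left; rewrite scale1r.
  + by right; right; rewrite scaleN1r.
- move=> Hl; apply: OmegaQ_eq_U_of_int => // n.
  have tE : t = 2%:R^-1 \/ t = - 2%:R^-1.
    rewrite /t; case: Hl => ->; [left|right]; rewrite -?scaleNr; exact: pair_beta_lambda2.
  rewrite !inE => /orP[]/eqP ->; case: tE => tE; [exists 0|exists (-1)|exists 1|exists 0] => //;
  by rewrite rootpair1 // -/t tE [true%:R]/(1 : R[i]) ?(rmorphN, rmorph1, rmorph0) /=; field.
- move=> Hl.
  have tp : t != 2%:R^-1 by apply/eqP => tE; apply: Hl; left; rewrite lamE tE.
  have tm : t != - 2%:R^-1 by apply/eqP => tE; apply: Hl; right; rewrite lamE tE scaleNr.
  apply: OmegaQ_eq_0_of_root => // n nb.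
  have hb : dotv (rootpair true lam n) (emb beta) = t - n%:~R - 2%:R^-1.
    by rewrite (dotv_simple _).1 rootpair1 // mul1r.
  have hab : dotv (rootpair true lam n) (emb (alpha + beta)) = t + n%:~R + 2%:R^-1.
    rewrite (dotv_simple _).2 rootpair0 // rootpair1 // -/t mul1r.
    rewrite rmorphD rmorphMn /= (_ : (true : int)%:~R = 1) //.
    by clearbody t; field.
  move: nb; rewrite !inE => /orP[]/eqP nE; rewrite {}nE in hb hab *.
  - have [Hv|Hu] := cubic_shift tp tm.
      by exists beta; split=> // x ->; rewrite hb subr0.
    by exists (alpha + beta); split=> // x ->; rewrite hab addr0.
  - have [Hv|Hu] := cubic_shift tp tm.
      exists (alpha + beta); split=> // x ->; rewrite hab.
      by rewrite (_ : t + _ + _ = t - 2%:R^-1) //; clearbody t; field.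
    exists beta; split=> // x ->; rewrite hb.
    by rewrite (_ : t - _ - _ = t + 2%:R^-1) //; clearbody t; field.
Qed.
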